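(* Let $(g_j^*,j\in\mathcal G,\ u_i^*,i\in\mathcal S,\ \lambda^* )$ be the competitive equilibrium of the prosumer based market described in the context with demand $d\in\mathbb R^T$. It solves the social planner problem $$\min_{g_j,\,u_i}\ \sum_{i\in\mathcal S}\frac{b_i}{2}u_i^TN_{E_i}(u_i)^TN_{E_i}(u_i)u_i+\sum_{j\in\mathcal G}\frac{c_j}{2}g_j^Tg_j\quad\text{s.t. } d=\sum_{j\in\mathcal G}g_j+\sum_{i\in\mathcal S}u_i$$ if and only if there exist coefficients $\gamma_k\ge0$, $k=1,\dots,m$, with $\sum_{k=1}^m\gamma_k=1$, such that $$\sum_{k=1}^m\gamma_kN_k(d)^TN_k(d)\,d=\frac{d^TN(d)^TN(d)d}{d^Td}\,d ,$$ where $N_1(d),\dots,N_m(d)$ are all the matrices associated with $d$ as defined in the context.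
   Context: **Storage model.** Fix $T\ge1$. For $u\in\mathbb R^T$ (discharge positive, charge negative) and capacity $E>0$, a state-of-charge (SoC) profile $x=(x_0,\dots,x_T)\in\mathbb R^{T+1}$ satisfies $x_t=x_{t-1}-\frac1E u_t$, i.e. $Ax=-\frac1E u$, where $A\in\mathbb R^{T\times(T+1)}$ has rows $A_{t}=e_{t}^T-e_{t-1}^T$ (columns indexed $0,\dots,T$), $t=1,\dots,T$. **Rainflow.** Given $x$, merge consecutive equal values (keeping the first) and keep the end points and the local extrema (turning points). While there are four consecutive remaining points $p,q,r,s$ with $|x_q-x_r|\le|x_p-x_q|$ and $|x_q-x_r|\le|x_r-x_s|$, take the leftmost such quadruple, record two half-cycles (one full cycle) on the pair $\{q,r\}$, each of depth $|x_q-x_r|$, and delete $q,r$. When no such quadruple remains, record one half-cycle for each pair of consecutive remaining points, with depth the absolute difference of their SoC values. At most $T$ half-cycles are recorded. $\mathrm{Rainflow}(x)=\nu\in\mathbb R^T$ lists the depths, padded with zeros (entries in nonincreasing order, ties in order of extraction). The incidence matrix $M(x)\in\mathbb R^{(T+1)\times T}$ has, for each half-cycle on a pair $\{p,q\}$ with $x_p>x_q$, a column $e_p-e_q$ (columns in the same order as the entries of $\nu$), and zero columns for the padding. So $M(x)^Tx=\nu$. $M(x)$ is unchanged when a constant is added to $x$. Define $N_E(u)=-\frac1E M(x)^TA^\dagger\in\mathbb R^{T\times T}$ ($A^\dagger$ the Moore–Penrose inverse, $x$ any profile with $Ax=-\frac1E u$); then $N_E(u)u=\nu$. The map is used for all vectors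 $u\in\mathbb R^T$, including price vectors and demand vectors. **Associated matrices.** The map $u\mapsto N_E(u)u$ is piecewise linear. At a given $u$, the associated matrices $N_1(u),\dots,N_m(u)$ are all the distinct matrices obtained as limits of $N_E(u^n)$ along sequences $u^n\to u$ of points near which $N_E$ is locally constant. They satisfy $N_k(u)u=N_E(u)u=\nu$ for all $k$. In the claim, $N(d)=N_E(d)$ and $N_k(d)$ are taken with one fixed $E>0$ (the condition does not depend on $E$). The degradation cost $u\mapsto\frac{b}{2}u^TN_E(u)^TN_E(u)u$ is known to be convex. **Prosumer based market.** $\mathcal G,\mathcal S$ are finite sets of generators and storage units. Generator $j$ has cost $\frac{c_j}{2}g_j^Tg_j$, $c_j>0$, for output $g_j\in\mathbb R^T$. Storage $i$ has capacity $E_i>0$ and degradation cost $\frac{b_i}{2}u_i^TN_{E_i}(u_i)^TN_{E_i}(u_i)u_i$, $b_i>0$, for rate $u_i\in\mathbb R^T$; $\mathcal S\neq\emptyset$. The demand is $d\in\mathbb R^T$, $d\neq0$. Generators bid scalars $\alpha_j\ge0$ and storage units bid scalars $\hat\beta_i\ge0$. The operator clears the market by minimizing $\sum_{i}\frac1{2\hat\beta_i}u_i^Tu_i+\sum_j\frac1{2\alpha_j}g_j^Tg_j$ subject only to the power balance $d=\sum_jg_j+\sum_iu_i$, whose dual variable $\lambda\in\mathbb R^T$ is the market-clearing price; dispatch is $g_j=\alpha_j\lambda$, $u_i=\hat\beta_i\lambda$, and participants are paid $\lambda^Tg_j$, $\lambda^Tu_i$. Throughout, only the power balance constraint is considered (all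 other operational constraints are assumed non-binding). **Competitive equilibrium.** Participants are price-taking (they treat $\lambda$ as given). $(\hat\beta_i,\alpha_j,\lambda)$ is a competitive equilibrium if: (1) for each $j$, $\alpha_j$ maximizes $\alpha\lambda^T\lambda-\alpha^2\frac{c_j}{2}\lambda^T\lambda$ over $\alpha\ge0$; (2) for each $i$, $\hat\beta_i$ maximizes $\beta\lambda^T\lambda-\frac{b_i\beta^2}{2}\lambda^TN_{E_i}(\beta\lambda)^TN_{E_i}(\beta\lambda)\lambda$ over $\beta\ge0$; (3) demand is met: $d=\sum_j\alpha_j\lambda+\sum_i\hat\beta_i\lambda$. The equilibrium dispatch and price are $g_j^*=\alpha_j\lambda^*$, $u_i^*=\hat\beta_i\lambda^*$, $\lambda^*=\lambda$.
   Formalization: With no generators, optimality of the dispatch alone does not imply the condition, so that equivalence is stated for nonempty G; for every G, including empty, it is stated with λ* also required to be an optimal dual price of the power balance. *)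

(* Defs.v *)
From HB Require Import structures.
From mathcomp Require Import all_boot all_order all_algebra.
From mathcomp Require Import all_classical all_reals all_analysis.

Set Implicit Arguments.
Unset Strict Implicit.
Unset Printing Implicit Defensive.

Import Order.TTheory GRing.Theory Num.Theory.
Import numFieldNormedType.Exports.

Local Open Scope classical_set_scope.
Local Open Scope ring_scope.

Section Rainflow.
(* A remaining point of the profile is represented by its index in [I]. *)
Context {R : realDomainType} {I : Type} (x : I -> R).

Fixpoint merge_from (a : I) (s : seq I) : seq I :=
  if s is b :: s' then
    if x b == x a then merge_from a s' else b :: merge_from b s'
  else [::].

Definition merge_equal (s : seq I) : seq I :=
  if s is a :: s' then a :: merge_from a s' else [::].

Definition extremum (a b c : I) : bool :=
  ((x a < x b) && (x c < x b)) || ((x b < x a) && (x b < x c)).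

(* [a] is the point just before [s] in the merged profile, whether or not it
   was itself kept. *)
Fixpoint turning_from (a : I) (s : seq I) : seq I :=
  match s with
  | b :: ((c :: _) as s') =>
      if extremum a b c then b :: turning_from b s' else turning_from b s'
  | _ => s
  end.

Definition turning_points (s : seq I) : seq I :=
  if merge_equal s is a :: s' then a :: turning_from a s' else [::].

Definition inner_cycle (p q r s : I) : bool :=
  (`|x q - x r| <= `|x p - x q|) && (`|x q - x r| <= `|x r - x s|).

(* Deletes the two middle points of the leftmost quadruple satisfying
   [inner_cycle], and returns them with the points that remain. *)
Fixpoint extract (l : seq I) : option ((I * I) * seq I) :=
  match l with
  | p :: ((q :: r :: s :: l') as l1) =>
      if inner_cycle p q r s then Some ((q, r), [:: p, s & l'])
      else if extract l1 is Some (c, l2) then Some (c, p :: l2) else None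
  | _ => None
  end.

(* Every extraction removes two points, so fuel [size l] is never exhausted
   before [extract] fails. *)
Fixpoint half_cycles_rec (fuel : nat) (l : seq I) : seq (I * I) :=
  if fuel is n.+1 then
    if extract l is Some (c, l') then [:: c, c & half_cycles_rec n l']
    else zip l (behead l)
  else zip l (behead l).

(* In order of extraction. *)
Definition half_cycles (s : seq I) : seq (I * I) :=
  let l := turning_points s in half_cycles_rec (size l) l.

Definition depth (c : I * I) : R := `|x c.1 - x c.2|.

(* [sort] is stable, so equal depths stay in order of extraction. *)
Definition sorted_half_cycles (s : seq I) : seq (I * I) :=
  sort (fun c c' => depth c' <= depth c) (half_cycles s).

Definition orient (c : I * I) : I * I :=
  if x c.2 < x c.1 then c else (c.2, c.1).

End Rainflow.

Section Storage.
Context {R : realType} {T : nat}.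

Definition soc_matrix : 'M[R]_(T, T.+1) :=
  \matrix_(t, s) ((s == lift ord0 t)%:R - (s == widen_ord (leqnSn T) t)%:R).

Definition penrose m n (A : 'M[R]_(m, n)) (B : 'M[R]_(n, m)) : Prop :=
  [/\ A *m B *m A = A, B *m A *m B = B,
      (A *m B)^T = A *m B & (B *m A)^T = B *m A].

(* The Moore-Penrose inverse: the unique matrix satisfying [penrose]; see
   [penrose_soc_matrix] for existence. *)
Definition mpinv m n (A : 'M[R]_(m, n)) : 'M[R]_(n, m) :=
  xget 0 [set B | penrose A B].

Definition sorted_cycles (x : 'cV[R]_T.+1) : seq ('I_T.+1 * 'I_T.+1) :=
  sorted_half_cycles (fun t => x t ord0) (enum 'I_T.+1).

Definition incidence (x : 'cV[R]_T.+1) : 'M[R]_(T.+1, T) :=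
  let col c : 'cV[R]_T.+1 :=
    let pq := orient (fun t => x t ord0) c in
    delta_mx pq.1 ord0 - delta_mx pq.2 ord0 in
  \matrix_(t, k) nth 0 (map col (sorted_cycles x)) k t ord0.

(* [incidence_rainflow] and [degradation_mx_rainflow] relate it to [incidence]
   and [degradation_mx]. *)
Definition rainflow (x : 'cV[R]_T.+1) : 'cV[R]_T :=
  \col_k nth 0 (map (depth (fun t => x t ord0)) (sorted_cycles x)) k.

(* The profile with [x_0 = 0]. By [incidence_shift] the choice of the initial
   state of charge does not matter for [incidence]. *)
Definition soc_profile (E : R) (u : 'cV[R]_T) : 'cV[R]_T.+1 :=
  \col_s (- E^-1 * \sum_(t < T | (t < s)%N) u t ord0).

Definition degradation_mx (E : R) (u : 'cV[R]_T) : 'M[R]_T :=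
  - E^-1 *: ((incidence (soc_profile E u))^T *m mpinv soc_matrix).

(* The set {N_1(u), ..., N_m(u)}; it is finite by [finite_associated_mx]. *)
Definition associated_mx (E : R) (u : 'cV[R]_T) : set 'M[R]_T :=
  [set N | exists v : nat -> 'cV[R]_T,
     [/\ v n @[n --> \oo] --> u,
         forall n, \forall w \near v n,
           degradation_mx E w = degradation_mx E (v n)
       & degradation_mx E (v n) @[n --> \oo] --> N]].

Definition dot (v w : 'cV[R]_T) : R := (v^T *m w) ord0 ord0.

(* v^T N_E(u)^T N_E(u) v *)
Definition degradation_form (E : R) (u v : 'cV[R]_T) : R :=
  let N := degradation_mx E u in dot v (N^T *m N *m v).

Definition degradation_cost (b E : R) (u : 'cV[R]_T) : R :=
  b / 2 * degradation_form E u u.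

Definition generation_cost (c : R) (g : 'cV[R]_T) : R := c / 2 * dot g g.

End Storage.

Section Market.
Context {R : realType} {T : nat} {G S : finType}.
Variables (c : G -> R) (b E : S -> R) (d : 'cV[R]_T).

Definition generator_profit (cj : R) (lambda : 'cV[R]_T) (a : R) : R :=
  a * dot lambda lambda - a ^+ 2 * (cj / 2) * dot lambda lambda.

Definition storage_profit (bi Ei : R) (lambda : 'cV[R]_T) (beta : R) : R :=
  beta * dot lambda lambda
  - bi * beta ^+ 2 / 2 * degradation_form Ei (beta *: lambda) lambda.

Definition maximizes_nonneg (f : R -> R) (a : R) : Prop :=
  0 <= a /\ forall a', 0 <= a' -> f a' <= f a.

Definition competitive_equilibrium
    (alpha : G -> R) (beta : S -> R) (lambda : 'cV[R]_T) : Prop :=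
  [/\ forall j, maximizes_nonneg (generator_profit (c j) lambda) (alpha j),
      forall i, maximizes_nonneg (storage_profit (b i) (E i) lambda) (beta i)
    & d = \sum_j alpha j *: lambda + \sum_i beta i *: lambda].

Definition social_cost (g : G -> 'cV[R]_T) (u : S -> 'cV[R]_T) : R :=
  \sum_i degradation_cost (b i) (E i) (u i)
  + \sum_j generation_cost (c j) (g j).

Definition power_balance (g : G -> 'cV[R]_T) (u : S -> 'cV[R]_T) : Prop :=
  d = \sum_j g j + \sum_i u i.

Definition solves_planner (g : G -> 'cV[R]_T) (u : S -> 'cV[R]_T) : Prop :=
  power_balance g u /\
  forall g' u', power_balance g' u' -> social_cost g u <= social_cost g' u'.

Definition lagrangian (g : G -> 'cV[R]_T) (u : S -> 'cV[R]_T)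
    (lambda : 'cV[R]_T) : R :=
  social_cost g u + dot lambda (d - (\sum_j g j + \sum_i u i)).

(* The dispatch is optimal and the price is an optimal dual variable of the
   power balance. *)
Definition solves_planner_with_price (g : G -> 'cV[R]_T) (u : S -> 'cV[R]_T)
    (lambda : 'cV[R]_T) : Prop :=
  solves_planner g u /\
  forall g' u', lagrangian g u lambda <= lagrangian g' u' lambda.

End Market.

Section Facts.
Context {R : realType} {T : nat}.
Implicit Types (x : 'cV[R]_T.+1) (u : 'cV[R]_T).

Lemma soc_profileE (E : R) u :
  soc_matrix *m soc_profile E u = - E^-1 *: u.
Proof.
apply/colP => t; rewrite !mxE.
under eq_bigr => s _ do rewrite mxE mulrBl.
rewrite sumrB (bigD1 (lift ord0 t)) //= eqxx mul1r big1; last first.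
  by move=> s /negbTE->; rewrite mul0r.
rewrite (bigD1 (widen_ord (leqnSn T) t)) //= eqxx mul1r big1; last first.
  by move=> s /negbTE->; rewrite mul0r.
rewrite !addr0 !mxE -mulrBr; congr (_ * _).
rewrite (bigD1 t) /=; last by rewrite /bump /= add1n ltnS.
rewrite (eq_bigl (fun s : 'I_T => (s < t)%N)) ?addrK // => s.
by rewrite /bump /= add1n ltnS ltn_neqAle andbC.
Qed.

Lemma half_cycles_shift (I : Type) (y : I -> R) (a : R) (s : seq I) :
  half_cycles (fun i => y i + a) s = half_cycles y s.
Proof.
set z := fun i => _.
have zB p q : z p - z q = y p - y q by rewrite /z opprD addrACA subrr addr0.
have zE p q : (z p == z q) = (y p == y q) by exact: (inj_eq (addIr a)).
have zlt p q : (z p < z q) = (y p < y q) by rewrite ltrD2r.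
have mergeE l b : merge_from z b l = merge_from y b l.
  by elim: l b => //= c l IH b; rewrite zE !IH.
have turnE l b : turning_from z b l = turning_from y b l.
  elim: l b => [//|c [//|c' l] IH] b.
  have {}IH := IH c; rewrite /= /extremum !zlt; rewrite /= /extremum !zlt in IH.
  by rewrite IH.
have extractE l : extract z l = extract y l.
  elim: l => [//|p [//|q [//|r [//|t l]]] IH].
  have ext w : extract w [:: p, q, r, t & l] =
      if inner_cycle w p q r t then Some ((q, r), [:: p, t & l])
      else if extract w [:: q, r, t & l] is Some (c, l2) then Some (c, p :: l2)
      else None by [].
  by rewrite !ext IH /inner_cycle !zB.
have recE n l : half_cycles_rec z n l = half_cycles_rec y n l.
  by elim: n l => [//|n IH] l /=; rewrite extractE; case: extract => [[c l']|]; rewrite ?IH.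
rewrite /half_cycles recE /turning_points.
have -> : merge_equal z s = merge_equal y s by case: s => //= b l; rewrite mergeE.
by case: merge_equal => // b l; rewrite turnE.
Qed.

Lemma incidence_shift x (a : R) : incidence (x + const_mx a) = incidence x.
Proof.
have shiftE : (fun t => (x + const_mx a) t ord0) = (fun t => x t ord0 + a).
  by apply/funext => t; rewrite !mxE.
rewrite /incidence /sorted_cycles /sorted_half_cycles shiftE half_cycles_shift.
have -> : depth (fun t => x t ord0 + a) = depth (fun t => x t ord0).
  by apply/funext => c; rewrite /depth opprD addrACA subrr addr0.
have -> : orient (fun t => x t ord0 + a) = orient (fun t => x t ord0).
  by apply/funext => c; rewrite /orient ltrD2r.
by [].
Qed.

Lemma incidence_rainflow x : (incidence x)^T *m x = rainflow x.
Proof.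
apply/colP => k; rewrite !mxE; set cs := sorted_cycles x.
under eq_bigr => t _ do rewrite !mxE -/cs.
have [kcs|csk] := ltnP k (size cs); last first.
  rewrite !nth_default ?size_map// big1// => t _.
  by rewrite mxE mul0r.
have c0 : 'I_T.+1 * 'I_T.+1 := (ord0, ord0).
rewrite !(nth_map c0)//; set c := nth c0 cs k.
under eq_bigr => t _ do rewrite !mxE !eqxx !andbT mulrBl.
rewrite sumrB (bigD1 (orient (fun t => x t ord0) c).1)//= eqxx mul1r big1; last first.
  by move=> s /negbTE->; rewrite mul0r.
rewrite (bigD1 (orient (fun t => x t ord0) c).2)//= eqxx mul1r big1; last first.
  by move=> s /negbTE->; rewrite mul0r.
rewrite !addr0 /orient /depth; case: ltP => /= h.
  by rewrite gtr0_norm ?subr_gt0.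
by rewrite ler0_norm ?opprB// subr_le0.
Qed.

Lemma penrose_soc_matrix :
  penrose (soc_matrix : 'M[R]_(T, T.+1)) (mpinv soc_matrix).
Proof.
apply: xgetPex; set A : 'M[R]_(T, T.+1) := soc_matrix.
have [B AB] : exists B, A *m B = 1%:M.
  exists (\matrix_(s, t) soc_profile (-1) (delta_mx t ord0) s ord0).
  apply/matrixP => t k.
  have /colP/(_ t) := soc_profileE (-1) (delta_mx k ord0); rewrite !mxE.
  rewrite invrN1 opprK mul1r eqxx andbT => <-.
  by apply: eq_bigr => s _; rewrite !mxE.
have U : A *m A^T \in unitmx.
  rewrite -row_free_unit -kermx_eq0; apply/eqP; set K := kermx _.
  have KA : K *m A *m (K *m A)^T = 0.
    by rewrite trmx_mul mulmxA -(mulmxA K) mulmx_ker mul0mx.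
  suff KA0 : K *m A = 0 by rewrite -(mulmx1 K) -AB mulmxA KA0 mul0mx.
  apply/matrixP => i j; rewrite [RHS]mxE.
  have /matrixP/(_ i i)/eqP := KA; rewrite !mxE.
  under eq_bigr => k _ do rewrite [(K *m A)^T k i]mxE -expr2.
  rewrite psumr_eq0 => [|k _]; last exact: sqr_ge0.
  move=> /allP/(_ j); rewrite mem_index_enum => /(_ isT)/=.
  by rewrite sqrf_eq0 => /eqP; rewrite mxE.
exists (A^T *m invmx (A *m A^T)).
have AAp : A *m (A^T *m invmx (A *m A^T)) = 1%:M by rewrite mulmxA mulmxV.
split.
- by rewrite AAp mul1mx.
- by rewrite -mulmxA AAp mulmx1.
- by rewrite AAp trmx1.
- by rewrite !trmx_mul trmx_inv trmx_mul !trmxK mulmxA.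
Qed.

Lemma soc_matrix_ker x : soc_matrix *m x = 0 -> x = const_mx (x ord0 ord0).
Proof.
move=> Ax0; apply/colP => s; rewrite mxE.
have step (t : 'I_T) : x (lift ord0 t) ord0 = x (widen_ord (leqnSn T) t) ord0.
  apply/eqP; rewrite -subr_eq0; have /colP/(_ t) := Ax0; rewrite !mxE => <-.
  under eq_bigr => k _ do rewrite mxE mulrBl.
  rewrite sumrB (bigD1 (lift ord0 t)) //= eqxx mul1r big1; last first.
    by move=> k /negbTE->; rewrite mul0r.
  rewrite (bigD1 (widen_ord (leqnSn T) t)) //= eqxx mul1r big1; last first.
    by move=> k /negbTE->; rewrite mul0r.
  by rewrite !addr0.
case: s => n; elim: n => [|n IH] nT; first by congr (x _ _); exact/val_inj.
have nT' : (n < T)%N by [].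
rewrite -(IH (ltnW nT)) -[Ordinal (ltnW nT)](_ : widen_ord _ (Ordinal nT') = _).
  by rewrite -step; congr (x _ _); exact/val_inj.
exact/val_inj.
Qed.

Lemma degradation_mx_rainflow (E : R) u :
  degradation_mx E u *m u = rainflow (soc_profile E u).
Proof.
set x := soc_profile E u; set A : 'M[R]_(T, T.+1) := soc_matrix.
have [AAA _ _ _] := penrose_soc_matrix; rewrite -/A in AAA.
have uE : - E^-1 *: u = A *m x by rewrite soc_profileE.
rewrite /degradation_mx -/x -scalemxAl scalemxAr uE -mulmxA.
have ker : A *m (mpinv A *m (A *m x) - x) = 0.
  by rewrite mulmxBr !mulmxA AAA subrr.
have /(congr1 (fun y => y + x)) := soc_matrix_ker ker; rewrite subrK.
move: (fun_of_matrix _ _ _) => a e; rewrite e mulmxDr.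
rewrite incidence_rainflow -[RHS]add0r; congr (_ + _).
have := incidence_rainflow (x + const_mx a).
rewrite incidence_shift mulmxDr incidence_rainflow.
suff -> : rainflow (x + const_mx a) = rainflow x.
  by move/eqP; rewrite -subr_eq0 addrC addrA addNr add0r => /eqP.
have shiftE : (fun t => (x + const_mx a) t ord0) = (fun t => x t ord0 + a).
  by apply/funext => t; rewrite !mxE.
rewrite /rainflow /sorted_cycles /sorted_half_cycles shiftE half_cycles_shift.
have -> // : depth (fun t => x t ord0 + a) = depth (fun t => x t ord0).
by apply/funext => c; rewrite /depth opprD addrACA subrr addr0.
Qed.

Lemma finite_range_degradation_mx (E : R) :
  finite_set (range (@degradation_mx R T E)).
Proof.
pose f (m : 'M[bool * bool]_(T.+1, T)) : 'M[R]_T :=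
  - E^-1 *: ((map_mx (fun ab : bool * bool => ab.1%:R - ab.2%:R) m)^T
             *m mpinv soc_matrix).
apply: (@sub_finite_set _ _ (range f)); last first.
  exact/finite_image/finite_finset.
move=> _ [u _ <-]; rewrite /f /degradation_mx.
set x := soc_profile E u; set cs := sorted_cycles x.
pose g t c := (t == (orient (fun t => x t ord0) c).1,
               t == (orient (fun t => x t ord0) c).2).
exists (\matrix_(t, k) nth (false, false) (map (g t) cs) k) => //.
congr (_ *: (_^T *m _)); apply/matrixP => t k; rewrite !mxE -/cs.
have [kcs|csk] := ltnP k (size cs); last first.
  by rewrite !nth_default ?size_map// !mxE subrr.
have c0 : 'I_T.+1 * 'I_T.+1 := (ord0, ord0).
by rewrite !(nth_map c0)// !mxE !eqxx !andbT.
Qed.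

Lemma finite_associated_mx (E : R) u : finite_set (associated_mx E u).
Proof.
apply: sub_finite_set (finite_range_degradation_mx E) => N [v [_ _ vN]].
have haus : hausdorff_space 'M[R]_T.
  move=> A B AB; apply/matrixP => i j; apply: (@Rhausdorff R).
  move=> U V AU BV; have [||C [CU CV]] := AB (fun C => U (C i j)) (fun C => V (C i j)).
  - exact: (@coord_continuous _ _ _ i j A).
  - exact: (@coord_continuous _ _ _ i j B).
  by exists (C i j).
have cl : closed (range (@degradation_mx R T E)).
  have [+ _] := @accessible_finite_set_closed 'M[R]_T; apply; last exact: finite_range_degradation_mx.
  exact: hausdorff_accessible.
have ev : \forall n \near \oo, range (@degradation_mx R T E) (degradation_mx E (v n)).
  by exists 0%N => // n _; exists (v n).
exact: (@closed_cvg _ _ \oo _ (fun n => degradation_mx E (v n)) (range (@degradation_mx R T E)) cl ev N vN).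
Qed.

End Facts.

(* Main.v *)
Require Import Defs.
From HB Require Import structures.
From mathcomp Require Import all_boot all_order all_algebra.
From mathcomp Require Import all_classical all_reals all_analysis.
From mathcomp Require Import ring lra.
Set Implicit Arguments.
Unset Strict Implicit.
Unset Printing Implicit Defensive.
Import Order.TTheory GRing.Theory Num.Theory.
Import numFieldNormedType.Exports.
Local Open Scope classical_set_scope.
Local Open Scope ring_scope.

(** Write [D u] for the sum of the squared half-cycle depths produced by the
rate [u], that is [u^T N(u)^T N(u) u].  At an equilibrium the price [lambda] is
a positive multiple of [d], and profit maximisation along the ray of [lambda]
fixes the bids: [alpha_j c_j = 1] and [beta_i b_i D(lambda) = |lambda|^2].
Since [D] is homogeneous of degree 2 and only rescaled by the capacity, the
dispatch is optimal exactly when some multiple of [d] is a subgradient of [D]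
at [d].  So the theorem amounts to: the subdifferential of [D] at [d] is the
convex hull of the gradients [2 N_k^T N_k d] of the pieces that meet at [d].
The multiple is then forced, by pairing with [d] and using
[|N_k d|^2 = D d].

Convexity of [D] is the heart of the matter.  For a threshold [c >= 0], the
sum of [(depth - c)_+] over all half-cycles equals the truncated variation of
the profile, the largest value of the sum of [(|x_t - x_s| - c)_+] over the
steps of a subsequence of times ([sum_half_cycles]): merging equal values and
dropping monotone points do not change it, extracting an inner cycle [{q, r}]
lowers it by exactly [2 (|x_q - x_r| - c)_+], and on a residual, whose
amplitudes first increase and then decrease, the full sequence is optimal.
A maximum of convex functions of the profile is convex, and a square is an
integral of truncations, [y^2 = 2 int_0^oo (y - c)_+ dc], so the sum of
squares is convex as well ([sum_sqr_depth_convex], [degradation_convex]).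

Sufficiency.  Where [N] is locally constant, [D] is a quadratic form whose
gradient is, by convexity, a global subgradient.  Subgradients pass to the
limit, so every [2 N_k^T N_k d] is a subgradient at [d], and so are their
convex combinations ([associated_subgradient], [conv_condition_supported]).

Necessity.  Points where [N] is locally constant are dense, because [N]
depends only on finitely many comparisons of linear functionals
([locally_constant_dense]).  Given a direction [h], move from [d] along
directions close to [h] through such points: finitely many matrices occur, so
one of them occurs at points [d + t h'] with [(t, h')] arbitrarily close to
[(0, h)]; it is associated with [d], and its gradient is at least as large
along [h] as the given subgradient ([directional_associated]).  By
Gordan's alternative the subgradient then lies in the convex hull
([subgradient_conv]).  This argument tolerates an error quadratic in the
perturbation, which is what trading storage against a generator of quadratic
cost produces. *)

(* The name is also used for extremal indices of finite types. *)
Local Notation extremum := Defs.extremum.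

(** * Truncated variation of a sequence of values *)

Section TruncatedVariation.
Context {R : realFieldType}.
Implicit Types (c y z k : R) (l : seq R).

Definition excess c y : R := Num.max 0 (`|y| - c).

Lemma excess_ge0 c y : 0 <= excess c y.
Proof. by rewrite /excess le_max lexx. Qed.

Lemma excess_ge c y : `|y| - c <= excess c y.
Proof. by rewrite /excess le_max lexx orbT. Qed.

Lemma excess_le c y M : 0 <= M -> `|y| - c <= M -> excess c y <= M.
Proof. by move=> M0 yM; rewrite /excess ge_max M0. Qed.

Lemma le_excess c y z : `|y| <= `|z| -> excess c y <= excess c z.
Proof.
move=> yz; apply: excess_le; first exact: excess_ge0.
by apply: le_trans (excess_ge _ _); rewrite lerD2r.
Qed.

Lemma excessN c y : excess c (- y) = excess c y.
Proof. by rewrite /excess normrN. Qed.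

Lemma excessB c y z : excess c (y - z) = excess c (z - y).
Proof. by rewrite -excessN opprB. Qed.

Lemma excess_small c y : `|y| <= c -> excess c y = 0.
Proof. by move=> yc; rewrite /excess max_l// subr_le0. Qed.

Lemma excess0 c : 0 <= c -> excess c 0 = 0.
Proof. by move=> c0; rewrite excess_small ?normr0. Qed.

Lemma excessP c y : excess c y = 0 \/ excess c y = `|y| - c.
Proof. by rewrite /excess; case: leP; [right|left]. Qed.

(** A convex function vanishing at [0] is superadditive on the half line. *)
Lemma excess_superadd c y z : 0 <= c -> 0 <= y -> 0 <= z ->
  excess c y + excess c z <= excess c (y + z).
Proof.
move=> c0 y0 z0; have := excess_ge c (y + z); have := excess_ge0 c (y + z).
rewrite ger0_norm ?addr_ge0//.
case: (excessP c y) => ->; case: (excessP c z) => ->;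
  rewrite ?(ger0_norm y0) ?(ger0_norm z0); lra.
Qed.

(** The pair [(a, y + z - a)] is more spread out than [(y, z)] and has the same
sum, so the convex truncation gives it the larger total. *)
Lemma excess_spread c a y z : 0 <= a -> a <= y -> a <= z ->
  excess c y + excess c z <= excess c a + excess c (y + z - a).
Proof.
move=> a0 ay az.
have := excess_ge c (y + z - a); have := excess_ge0 c (y + z - a).
have := excess_ge c a; have := excess_ge0 c a.
have [y0 z0] : 0 <= y /\ 0 <= z by split; lra.
rewrite (ger0_norm a0) (_ : `|y + z - a| = y + z - a); last by rewrite ger0_norm; lra.
case: (excessP c y) => ->; case: (excessP c z) => ->;
  rewrite ?(ger0_norm y0) ?(ger0_norm z0); lra.
Qed.

Lemma excess_convex c s t y z : 0 <= s -> 0 <= t -> s + t = 1 ->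
  excess c (s * y + t * z) <= s * excess c y + t * excess c z.
Proof.
move=> s0 t0 st1; apply: excess_le.
  by rewrite addr_ge0 // mulr_ge0 // excess_ge0.
have ->: c = s * c + t * c by rewrite -mulrDl st1 mul1r.
have n : `|s * y + t * z| <= s * `|y| + t * `|z|.
  by apply: le_trans (ler_normD _ _) _; rewrite !normrM (ger0_norm s0) (ger0_norm t0).
have := ler_wpM2l s0 (excess_ge (s * c + t * c) y).
have := ler_wpM2l t0 (excess_ge (s * c + t * c) z).
rewrite !mulrBr.
have e : s * c + t * c = c by rewrite -mulrDl st1 mul1r.
by rewrite !e; lra.
Qed.

(** The truncated variation with threshold [c] of the profile [a :: l]: the
maximum, over subsequences starting at [a], of the sum of truncated increments.
The recursion decides whether the next value is visited.  It is Lipschitz and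
convex in all values jointly, which the list of half-cycles hides. *)
Fixpoint trunc_var c a l : R :=
  if l is b :: l' then
    Num.max (trunc_var c a l') (excess c (b - a) + trunc_var c b l')
  else 0.

Lemma trunc_var_skip c a b l : trunc_var c a l <= trunc_var c a (b :: l).
Proof. by rewrite /= le_max lexx. Qed.

Lemma trunc_var_step c a b l :
  excess c (b - a) + trunc_var c b l <= trunc_var c a (b :: l).
Proof. by rewrite /= le_max lexx orbT. Qed.

Lemma trunc_var_le c a b l M : trunc_var c a l <= M ->
  excess c (b - a) + trunc_var c b l <= M -> trunc_var c a (b :: l) <= M.
Proof. by move=> h1 h2; rewrite /= ge_max h1. Qed.

Lemma trunc_var_dup c a l : 0 <= c -> trunc_var c a (a :: l) = trunc_var c a l.
Proof. by move=> c0; rewrite /= subrr excess0 // add0r maxxx. Qed.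

Lemma trunc_varN c a l : trunc_var c (- a) (map -%R l) = trunc_var c a l.
Proof.
by elim: l a => [//|b l IH] a /=; rewrite !IH -opprD excessN.
Qed.

(** Each branch of the recursion is a sum of convex functions of the values, and
a maximum of convex functions is convex. *)
Lemma trunc_var_convex (I : Type) c (x y : I -> R) (s t : R) a (l : seq I) :
  0 <= s -> 0 <= t -> s + t = 1 ->
  trunc_var c (s * x a + t * y a) (map (fun i => s * x i + t * y i) l) <=
    s * trunc_var c (x a) (map x l) + t * trunc_var c (y a) (map y l).
Proof.
move=> s0 t0 st1; elim: l a => [|b l IH] a; first by rewrite /= !mulr0 addr0.
rewrite !map_cons; apply: trunc_var_le.
  apply: le_trans (IH a) _.
  by apply: lerD; apply: ler_wpM2l => //; apply: trunc_var_skip.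
have -> : s * x b + t * y b - (s * x a + t * y a) =
          s * (x b - x a) + t * (y b - y a) by ring.
have e1 := excess_convex c (x b - x a) (y b - y a) s0 t0 st1.
have h1 := ler_wpM2l s0 (trunc_var_step c (x a) (x b) (map x l)).
have h2 := ler_wpM2l t0 (trunc_var_step c (y a) (y b) (map y l)).
rewrite mulrDr in h1; rewrite mulrDr in h2.
by have := IH b; lra.
Qed.

(** As a function of one intermediate value, the best continuation is convex, so
a visit to [m] is dominated by a visit to one of the ends of any interval that
contains [m].  Every exchange argument below that moves a visited point reduces
to this. *)
Lemma trunc_var_quasiconvex c k l b m d M : b <= m -> m <= d ->
  excess c (b - k) + trunc_var c b l <= M ->
  excess c (d - k) + trunc_var c d l <= M ->
  excess c (m - k) + trunc_var c m l <= M.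
Proof.
move=> bm md hb hd.
have [bd|bd] := eqVneq b d.
  have mb : m = b by apply/le_anti; rewrite bm bd md.
  by rewrite mb.
have db0 : 0 < d - b by rewrite subr_gt0 lt_neqAle bd (le_trans bm).
pose t := (m - b) / (d - b).
have t0 : 0 <= t by apply: divr_ge0; lra.
have t1 : 0 <= 1 - t by rewrite subr_ge0 ler_pdivrMr // mul1r lerD2r.
have st : 1 - t + t = 1 by ring.
have mE : m = (1 - t) * b + t * d by rewrite /t; field; rewrite gt_eqF.
have h := @trunc_var_convex (R * R) c fst snd (1 - t) t (b, d)
  (map (fun e => (e, e)) l) t1 t0 st.
rewrite /= -!map_comp -mE in h.
have E1 : map (fst \o (fun e : R => (e, e))) l = l by rewrite map_id_in.
have E3 : map ((fun i : R * R => (1 - t) * i.1 + t * i.2) \o (fun e => (e, e))) l = l.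
  by rewrite map_id_in // => e _ /=; rewrite -mulrDl st mul1r.
rewrite E1 E3 in h.
have e1 := excess_convex c (b - k) (d - k) t1 t0 st.
have E4 : (1 - t) * (b - k) + t * (d - k) = m - k by rewrite mE; ring.
rewrite E4 in e1.
have h1 := ler_wpM2l t1 hb; have h2 := ler_wpM2l t0 hd.
rewrite !mulrDr in h1 h2; have -> : M = (1 - t) * M + t * M by ring.
lra.
Qed.

Lemma trunc_var_lipschitz c a b l : 0 <= c ->
  trunc_var c a l <= `|a - b| + trunc_var c b l.
Proof.
move=> c0; elim: l a b => [|d l IH] a b; first by rewrite /= addr0.
apply: trunc_var_le.
  by apply: le_trans (IH a b) _; rewrite lerD2l trunc_var_skip.
apply: (@le_trans _ _ (`|a - b| + (excess c (d - b) + trunc_var c d l))).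
  rewrite addrA lerD2r; apply: excess_le.
    by rewrite addr_ge0 ?normr_ge0 ?excess_ge0.
  have := ler_normD (d - b) (b - a); rewrite addrA subrK.
  by have := excess_ge c (d - b); rewrite (distrC b a); lra.
by rewrite lerD2l trunc_var_step.
Qed.

(** Starting lower loses nothing when a point [s] above both starts comes next:
a continuation that goes up only gains, and one that goes down can first
collect the climb to [s]. *)
Lemma trunc_var_far_up c r k s l : 0 <= c -> r <= k -> k <= s ->
  trunc_var c k (s :: l) <= trunc_var c r (s :: l).
Proof.
move=> c0 rk ks.
suff h : forall M, trunc_var c r l <= M -> excess c (s - r) + trunc_var c s l <= M ->
    trunc_var c k l <= M.
  apply: trunc_var_le.
    by apply: h; [exact: trunc_var_skip | exact: trunc_var_step].
  apply: le_trans (trunc_var_step _ _ _ _); rewrite lerD2r.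
  by apply: le_excess; rewrite !ger0_norm; lra.
elim: l => [|f l IH] M h1 h2 //.
apply: trunc_var_le.
  apply: IH; first exact: le_trans (trunc_var_skip _ _ _ _) h1.
  by apply: le_trans h2; rewrite lerD2l trunc_var_skip.
have [kf|fk] := leP k f.
  apply: le_trans h1; apply: le_trans (trunc_var_step _ _ _ _).
  by rewrite lerD2r; apply: le_excess; rewrite !ger0_norm; lra.
apply: le_trans h2.
have := trunc_var_step c s f l.
have : excess c (f - k) <= excess c (f - s).
  by apply: le_excess; rewrite !ler0_norm; lra.
have := excess_ge0 c (s - r); lra.
Qed.

Lemma trunc_var_far_down c r k s l : 0 <= c -> k <= r -> s <= k ->
  trunc_var c k (s :: l) <= trunc_var c r (s :: l).
Proof.
move=> c0 rk ks; rewrite -[leLHS]trunc_varN -[leRHS]trunc_varN.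
by apply: trunc_var_far_up; rewrite ?lerN2.
Qed.

(** From [p], the far end [q] is at least as rewarding a first stop as any point
that follows. *)
Lemma trunc_var_hull c p q l : 0 <= c ->
  all (fun f => `|f - p| <= `|q - p|) l ->
  trunc_var c p l <= excess c (q - p) + trunc_var c q l.
Proof.
move=> c0; elim: l => [|f l IH] /=; first by rewrite addr0 excess_ge0.
move=> /andP[fp /IH h]; rewrite ge_max; apply/andP; split.
  by apply: le_trans h _; rewrite lerD2l trunc_var_skip.
apply: lerD; first exact: le_excess.
by rewrite le_max; apply/orP; right; rewrite lerDr excess_ge0.
Qed.

(** A point between its two neighbours is redundant, whatever precedes. *)
Lemma trunc_var_monotone c k b m d l : 0 <= c ->
  (b <= m <= d) || (d <= m <= b) ->
  trunc_var c k [:: b, m, d & l] = trunc_var c k [:: b, d & l].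
Proof.
move=> c0 bmd; apply/eqP; rewrite eq_le; apply/andP; split; last first.
  apply: trunc_var_le.
    by apply: le_trans (trunc_var_skip _ _ _ _); apply: trunc_var_skip.
  apply: le_trans (trunc_var_step _ _ _ _).
  by rewrite lerD2l trunc_var_skip.
(* A visit to the middle point is dominated by a visit to one of its two
   neighbours, whatever comes before. *)
have key k' M : excess c (b - k') + trunc_var c b (d :: l) <= M ->
    trunc_var c k' (d :: l) <= M -> excess c (m - k') + trunc_var c m (d :: l) <= M.
  move=> h1 h2.
  have h3 : excess c (d - k') + trunc_var c d (d :: l) <= M.
    by rewrite trunc_var_dup //; apply: le_trans h2; apply: trunc_var_step.
  case/orP: bmd => /andP[? ?].
    exact: (@trunc_var_quasiconvex _ _ _ b _ d).
  exact: (@trunc_var_quasiconvex _ _ _ d _ b).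
have skip := trunc_var_skip c k b (d :: l).
have step := trunc_var_step c k b (d :: l).
apply: trunc_var_le.
  by apply: trunc_var_le => //; apply: key.
rewrite addrC -lerBrDr; apply: trunc_var_le; first by rewrite lerBrDr addrC.
apply: key; last by rewrite lerBrDr addrC.
by rewrite subrr excess0 // add0r lerBrDr addrC.
Qed.

(** The hard case of an extraction: the path visits the top [q] and the bottom
[r] of the inner cycle, and then leaves for an arbitrary continuation [L].
Not counting the step from [q] to [r], replacing this passage by a visit to
[p], to [s], or to neither loses at most the truncated depth of the cycle. *)
Lemma trunc_var_swap c k p q r s L M : 0 <= c -> p <= r -> r <= q -> q <= s ->
  trunc_var c k L <= M ->
  excess c (p - k) + trunc_var c p L <= M ->
  excess c (s - k) + trunc_var c s L <= M ->
  excess c (q - k) + trunc_var c r L <= excess c (q - r) + M.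
Proof.
move=> c0 pr rq qs; elim: L M => [|f L IH] M h1 h2 h3.
  have := excess_ge0 c (q - r).
  have [kq|qk] := leP k q.
    have : excess c (q - k) <= excess c (s - k) by apply: le_excess; rewrite !ger0_norm; lra.
    rewrite /= in h3 *; lra.
  have : excess c (q - k) <= excess c (p - k) by apply: le_excess; rewrite !ler0_norm; lra.
  rewrite /= in h2 *; lra.
rewrite addrC -lerBrDr; apply: trunc_var_le; rewrite lerBrDr addrC.
  apply: IH.
  - exact: le_trans (trunc_var_skip _ _ _ _) h1.
  - by apply: le_trans h2; rewrite lerD2l trunc_var_skip.
  - by apply: le_trans h3; rewrite lerD2l trunc_var_skip.
have := trunc_var_step c k f L; have := trunc_var_step c p f L.
have := trunc_var_step c s f L.
have := excess_ge0 c (q - r).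
have [kq|qk] := leP k q; last first.
  have : excess c (q - k) <= excess c (p - k) by apply: le_excess; rewrite !ler0_norm; lra.
  have [fr|rf] := leP f r; last first.
    have : excess c (f - r) <= excess c (f - p) by apply: le_excess; rewrite !ger0_norm; lra.
    lra.
  have : excess c (q - k) + excess c (f - r) <= excess c (f - k) + excess c (q - r).
    have : excess c (q - k) <= excess c (r - k) by apply: le_excess; rewrite !ler0_norm; lra.
    have := @excess_superadd c (k - r) (r - f) c0.
    rewrite -(excessB c f r) (excessB c r k) (excessB c f k).
    have -> : k - r + (r - f) = k - f by ring.
    have := excess_ge0 c (q - r).
    by move=> ? h ?; have := h _ _; lra.
  lra.
have qsk : excess c (q - k) <= excess c (s - k) by apply: le_excess; rewrite !ger0_norm; lra.
have [fr|rf] := leP f r.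
  have : excess c (f - r) <= excess c (f - s) by apply: le_excess; rewrite !ler0_norm; lra.
  lra.
have [fq|qf] := leP f q.
  have : excess c (f - r) <= excess c (q - r) by apply: le_excess; rewrite !ger0_norm; lra.
  have := excess_ge0 c (f - s); lra.
have [kr|rk] := leP k r.
  have := @excess_spread c (q - r) (q - k) (f - r).
  have -> : q - k + (f - r) - (q - r) = f - k by ring.
  by move=> h; have := h _ _ _; lra.
have : excess c (q - k) <= excess c (q - r) by apply: le_excess; rewrite !ger0_norm; lra.
have : excess c (f - r) <= excess c (f - p) by apply: le_excess; rewrite !ger0_norm; lra.
have := excess_ge0 c (p - k); lra.
Qed.

(** An inner cycle contributes its truncated depth twice, once on the way down
and once on the way back, independently of the rest of the path. *)
Lemma trunc_var_extract_up c k p q r s l : 0 <= c -> p <= r -> r <= q -> q <= s ->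
  trunc_var c k [:: p, q, r, s & l] =
    excess c (q - r) *+ 2 + trunc_var c k [:: p, s & l].
Proof.
move=> c0 pr rq qs; set L := s :: l; set e := excess c (q - r).
have e0 : 0 <= e := excess_ge0 _ _.
have sL : trunc_var c s L = trunc_var c s l by rewrite trunc_var_dup.
rewrite mulr2n; apply/eqP; rewrite eq_le; apply/andP; split.
  have bnd k' M : trunc_var c k' L <= M ->
      excess c (p - k') + trunc_var c p L <= M ->
      trunc_var c k' [:: q, r & L] <= e + e + M.
    move=> h1 h2.
    have h3 : excess c (s - k') + trunc_var c s L <= M.
      by rewrite sL; apply: le_trans h1; apply: trunc_var_step.
    have hr : excess c (r - k') + trunc_var c r L <= M.
      by apply: (@trunc_var_quasiconvex _ _ _ p _ s) => //; lra.
    have hq : excess c (q - k') + trunc_var c q L <= M.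
      by apply: (@trunc_var_quasiconvex _ _ _ p _ s) => //; lra.
    apply: trunc_var_le; first by apply: trunc_var_le; lra.
    rewrite addrC -lerBrDr; apply: trunc_var_le; first lra.
    have := @trunc_var_swap c k' p q r s L M c0 pr rq qs h1 h2 h3.
    by rewrite -/e (excessB c r q) -/e; lra.
  apply: trunc_var_le; first by apply: bnd; [exact: trunc_var_skip|exact: trunc_var_step].
  have := bnd p (trunc_var c p L) (lexx _); rewrite subrr excess0 // add0r => /(_ (lexx _)).
  by have := trunc_var_step c k p L; lra.
(* If the cycle is below the threshold only monotonicity is needed; otherwise
   its truncated depth is affine in the depth. *)
have [d0|dn0] : e = 0 \/ e = q - r - c.
- have [h|h] := excessP c (q - r); first by left.
  by right; rewrite /e h ger0_norm // subr_ge0.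
- rewrite d0 !add0r; apply: trunc_var_le.
    do 2 apply: le_trans (trunc_var_skip _ _ _ _); exact: trunc_var_skip.
  apply: le_trans (trunc_var_step _ _ _ _); rewrite lerD2l.
  by apply: le_trans (trunc_var_skip _ _ _ _); apply: trunc_var_skip.
(* From below [r], the detour through the cycle is as good as starting at [r]:
   the climb to [q] pays for the distance to [r] plus the first half-cycle. *)
have low k' : k' <= r -> e + e + trunc_var c k' L <= trunc_var c k' [:: q, r & L].
  move=> kr; have := trunc_var_step c k' q (r :: L).
  have := trunc_var_step c q r L; rewrite (excessB c r q) -/e.
  have := trunc_var_lipschitz k' r L c0; rewrite distrC ger0_norm ?subr_ge0 //.
  have := excess_ge c (q - k'); rewrite ger0_norm; lra.
rewrite addrC -lerBrDr; apply: trunc_var_le; last first.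
  by have := low p pr; have := trunc_var_step c k p [:: q, r & L]; lra.
have [kr|rk] := leP k r.
  by have := low k kr; have := trunc_var_skip c k p [:: q, r & L]; lra.
have pq : e <= excess c (q - p) by apply: le_excess; rewrite !ger0_norm; lra.
have step := trunc_var_step c k p [:: q, r & L].
have step2 := trunc_var_step c p q (r :: L).
have [ks|sk] := leP k s.
  have := @trunc_var_far_up c r k s l c0 (ltW rk) ks; rewrite -/L.
  have := trunc_var_step c q r L; rewrite (excessB c r q) -/e.
  have := excess_ge0 c (p - k); lra.
have := trunc_var_skip c q r L.
have := trunc_var_lipschitz k q L c0; rewrite ger0_norm; last lra.
have := excess_ge c (p - k); rewrite ler0_norm; lra.
Qed.

Lemma trunc_var_extract c k p q r s l : 0 <= c ->
  (p <= r) && (r <= q) && (q <= s) || (s <= q) && (q <= r) && (r <= p) ->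
  trunc_var c k [:: p, q, r, s & l] =
    excess c (q - r) *+ 2 + trunc_var c k [:: p, s & l].
Proof.
move=> c0 /orP[] /andP[/andP[h1 h2] h3]; first exact: trunc_var_extract_up.
rewrite -[LHS]trunc_varN -[trunc_var _ _ [:: p, s & l]]trunc_varN.
by rewrite !map_cons trunc_var_extract_up ?lerN2 // -opprD excessN.
Qed.

End TruncatedVariation.

(** * Turning points and extraction of cycles preserve the truncated variation *)

Section HalfCycles.
Context {R : realFieldType} {I : Type} (x : I -> R).
Implicit Types (c k : R) (l s : seq I).

Definition between (a b d : I) : bool := (x a <= x b <= x d) || (x d <= x b <= x a).

(** The invariant of the extraction loop: consecutive increments alternate in
sign.  It is what turns the comparison of distances in [inner_cycle] into the
nesting of intervals that the exchange arguments need. *)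
Fixpoint zigzag l : bool :=
  if l is p :: ((q :: r :: _) as l') then extremum x p q r && zigzag l' else true.

Lemma turning_from_cons (a b d : I) s : turning_from x a [:: b, d & s] =
  if extremum x a b d then b :: turning_from x b (d :: s)
  else turning_from x b (d :: s).
Proof. by []. Qed.

Lemma extract_cons (p q r t : I) l : extract x [:: p, q, r, t & l] =
  if inner_cycle x p q r t then Some ((q, r), [:: p, t & l])
  else if extract x [:: q, r, t & l] is Some (h, l2) then Some (h, p :: l2)
  else None.
Proof. by []. Qed.

Lemma trunc_var_congr c l l' (b : I) :
  (forall k, trunc_var c k (map x l) = trunc_var c k (map x l')) ->
  forall k, trunc_var c k (map x (b :: l)) = trunc_var c k (map x (b :: l')).
Proof. by move=> h k /=; rewrite !h. Qed.

Lemma trunc_var_merge c a s k : 0 <= c ->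
  trunc_var c k (map x (a :: merge_from x a s)) = trunc_var c k (map x (a :: s)).
Proof.
move=> c0; elim: s a k => [//|b s IH] a k.
rewrite [merge_from _ _ _]/=; case: eqP => [ba|_]; last first.
  by apply: trunc_var_congr => k'; apply: IH.
rewrite IH /= ba subrr excess0 // add0r maxxx -maxA maxxx.
by [].
Qed.

Lemma merge_from_path a s :
  path (fun u v => x v != x u) a (merge_from x a s).
Proof. by elim: s a => [//|b s IH] a /=; case: ifPn => [_|ba] //=; rewrite ba IH. Qed.

Lemma size_merge_from a s : (size (merge_from x a s) <= size s)%N.
Proof. by elim: s a => [//|b s IH] a /=; case: ifP => _; [exact: leqW|exact: IH]. Qed.

Lemma size_turning_from a s : (size (turning_from x a s) <= size s)%N.
Proof.
elim: s a => [//|b [//|d s] IH] a; have := IH b.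
rewrite [turning_from x a _]/=; case: ifP => _ //; exact: leqW.
Qed.

(** [k] is the last point kept and [a] the last point seen; the values from [k]
to [a] to the next point [b] are monotone, so dropping [b] when it is not an
extremum is an instance of [trunc_var_monotone]. *)
Lemma trunc_var_turning c s (a k b : I) : 0 <= c ->
  path (fun u v => x v != x u) a (b :: s) -> between k a b ->
  forall m, trunc_var c m (map x (k :: turning_from x a (b :: s))) =
    trunc_var c m (map x [:: k, b & s]).
Proof.
move=> c0; elim: s a k b => [//|d s IH] a k b pth kab m.
have pth' : path (fun u v => x v != x u) b (d :: s) by case/andP: pth.
have [ba db] : x b != x a /\ x d != x b by case/and3P: pth.
rewrite turning_from_cons; case: ifPn => [_|nex].
  apply: trunc_var_congr => m'; apply: IH => //.
  by rewrite /between lexx /=; case: (leP (x b) (x d)) => // /ltW ->.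
have kbd : between k b d.
  by move: nex kab ba db; rewrite /extremum /between => *; lra.
rewrite IH // !map_cons trunc_var_monotone //.
Qed.

(** The first point kept after [k] lies beyond [b] on the side of the current
monotone run, which gives the alternation at [k]. *)
Lemma zigzag_turning s (a k b : I) : path (fun u v => x v != x u) a (b :: s) ->
  (x k <= x a < x b) || (x b < x a <= x k) ->
  exists z r, [/\ turning_from x a (b :: s) = z :: r, zigzag [:: k, z & r]
    & (x k <= x a < x b) && (x b <= x z) || (x b < x a <= x k) && (x z <= x b)].
Proof.
elim: s a k b => [|d s IH] a k b pth kab.
  by exists b, [::]; split => //; rewrite !lexx !andbT.
have pth' : path (fun u v => x v != x u) b (d :: s) by case/andP: pth.
have [ba db] : x b != x a /\ x d != x b by case/and3P: pth.
rewrite turning_from_cons; case: ifPn => [ex|nex].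
  have [||z [r [-> zz h]]] := IH b b d => //.
    by rewrite lexx /= andbT -neq_lt eq_sym.
  exists b, (z :: r); split => //; last by rewrite !lexx !andbT.
  apply/andP; split => //.
  by move: ex kab h; rewrite /extremum => *; lra.
have kbd : (x k <= x b < x d) || (x d < x b <= x k).
  by move: nex kab ba db; rewrite /extremum => *; lra.
have [z [r [-> zz h]]] := IH b k d pth' kbd.
exists z, r; split => //; lra.
Qed.

(** One round of the loop.  The last conjunct says that the direction of the
first increment survives, so that alternation is preserved when further points
precede. *)
Lemma extract_spec l h l2 : zigzag l -> extract x l = Some (h, l2) ->
  [/\ forall c k, 0 <= c -> trunc_var c k (map x l) =
        excess c (depth x h) *+ 2 + trunc_var c k (map x l2),
      zigzag l2, size l = (size l2).+2
    & exists q r m r' m', [/\ l = [:: q, r & m], l2 = [:: q, r' & m'] &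
        (x q < x r -> x q < x r') /\ (x r < x q -> x r' < x q)]].
Proof.
elim: l h l2 => [//|p [//|q [//|r [//|s l]]] IH] h l2 zz.
rewrite extract_cons.
have [pqr qrs zz'] : [/\ extremum x p q r, extremum x q r s & zigzag [:: r, s & l]].
  by case/and3P: zz.
have zz1 : zigzag [:: q, r, s & l] by apply/andP; split.
case: ifPn => [/andP[h1 h2] [<- <-]|_].
  have bet : (x p <= x r) && (x r <= x q) && (x q <= x s) ||
      (x s <= x q) && (x q <= x r) && (x r <= x p).
    move: pqr qrs h1 h2 => /orP[] /andP[pq rq] qrs; rewrite /extremum in qrs.
      rewrite (gtr0_norm (_ : 0 < x q - x r)) ?subr_gt0 // distrC.
      rewrite (gtr0_norm (_ : 0 < x q - x p)) ?subr_gt0 // distrC.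
      by rewrite gtr0_norm ?subr_gt0 => *; lra.
    rewrite distrC (gtr0_norm (_ : 0 < x r - x q)) ?subr_gt0 //.
    rewrite (gtr0_norm (_ : 0 < x p - x q)) ?subr_gt0 //.
    by rewrite gtr0_norm ?subr_gt0 => *; lra.
  split => //.
  - move=> c k c0; rewrite !map_cons trunc_var_extract // /depth /=.
    by rewrite /excess normr_id.
  - case: l {IH zz zz1} zz' => // t l /andP[rst zzl]; rewrite /= -/(zigzag _).
    apply/andP; split; last by [].
    move: pqr qrs rst bet; rewrite /extremum => *; lra.
  - exists p, q, [:: r, s & l], s, l; split => //.
    move: pqr qrs bet; rewrite /extremum => *; split; lra.
case E : extract => [[c' l3]|] // [<- <-].
have [H zz3 sz [q1 [r1 [m [r' [m' [[<- <- em] el3 hh]]]]]]] := IH _ _ zz1 E.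
split.
- move=> c k c0.
  have consE L : trunc_var c k (map x (p :: L)) = Num.max (trunc_var c k (map x L))
      (excess c (x p - k) + trunc_var c (x p) (map x L)) by [].
  by rewrite !consE !H // addrCA -addr_maxr.
- rewrite el3 in zz3 *; apply/andP; split => //.
  case: hh pqr; rewrite /extremum => *; lra.
- by rewrite /= -sz.
- exists p, q, [:: r, s & l], q, (r' :: m'); rewrite el3; split => //.
Qed.

End HalfCycles.

(** * Half-cycle depths: truncated sums and sums of squares *)

Section HalfCycleSums.
Context {R : realFieldType} {I : Type} (x : I -> R).
Implicit Types (c : R) (l s : seq I).

(** When nothing can be extracted and the amplitudes have stopped increasing,
they keep decreasing, so all later points stay between [q] and [r]. *)
Lemma extract_none_nested p q r l : zigzag x [:: p, q, r & l] ->
  extract x [:: p, q, r & l] = None -> `|x q - x r| <= `|x p - x q| ->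
  all (fun f => between x q f r) (r :: l).
Proof.
elim: l p q r => [|s l IH] p q r zz; first by rewrite /= /between !lexx; lra.
rewrite extract_cons.
case: ifPn => // nin; case E : (extract x [:: q, r, s & l]) => [[]|] // _ qr.
have rs : `|x r - x s| < `|x q - x r| by rewrite ltNge; move: nin; rewrite /inner_cycle qr.
have [pqr qrs zz'] : [/\ extremum x p q r, extremum x q r s & zigzag x [:: r, s & l]].
  by case/and3P: zz.
have zz1 : zigzag x [:: q, r, s & l] by apply/andP; split.
have h := IH q r s zz1 E (ltW rs).
have qsr : between x q s r.
  move: qrs rs; rewrite /extremum /between => /orP[] /andP[qr' sr].
    rewrite gtr0_norm ?subr_gt0 // distrC gtr0_norm ?subr_gt0 //; lra.
  rewrite distrC gtr0_norm ?subr_gt0 // gtr0_norm ?subr_gt0 //; lra.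
rewrite [all _ _]/=; apply/andP; split.
  by rewrite /between; lra.
apply: sub_all h => f; move: qsr; rewrite /between; lra.
Qed.

(** In the residual no point is worth skipping: while the amplitudes increase,
the next swing goes past the starting point ([trunc_var_far_up] and its mirror
image); once they decrease, the next point is the far end of all that follows
([trunc_var_hull]). *)
Lemma trunc_var_residual c p l : 0 <= c -> zigzag x (p :: l) ->
  extract x (p :: l) = None ->
  \sum_(h <- zip (p :: l) l) excess c (depth x h) = trunc_var c (x p) (map x l).
Proof.
move=> c0; elim: l p => [|q l IH] p zz none; first by rewrite big_nil.
have zz' : zigzag x (q :: l) by case: l zz {IH none} => // r l /andP[].
have none' : extract x (q :: l) = None.
  case: l none {IH zz zz'} => [//|r [//|s l]].
  by rewrite extract_cons; case: ifP => // _; case: extract => // -[].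
rewrite [zip _ _]/= big_cons (IH q zz' none') /depth.
have -> : excess c `|x (p, q).1 - x (p, q).2| = excess c (x q - x p).
  by rewrite /excess normr_id distrC.
have -> : trunc_var c (x p) (map x (q :: l)) = Num.max (trunc_var c (x p) (map x l))
  (excess c (x q - x p) + trunc_var c (x q) (map x l)) by [].
apply/esym/max_idPr.
case: l zz none {IH zz' none'} => [|r l] zz none.
  by rewrite /= addr0 excess_ge0.
have pqr : extremum x p q r by case/andP: zz.
have [pq|pq] := leP `|x q - x r| `|x p - x q|.
  apply: trunc_var_hull => //; rewrite all_map.
  apply: sub_all (extract_none_nested zz none pq) => f /=.
  move: pqr pq; rewrite /extremum /between => /orP[] /andP[h1 h2].
    rewrite gtr0_norm ?subr_gt0 // distrC gtr0_norm ?subr_gt0 // => h3 h4.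
    by rewrite ger0_norm; lra.
  rewrite distrC gtr0_norm ?subr_gt0 // gtr0_norm ?subr_gt0 // => h3 h4.
  by rewrite ler0_norm ?(distrC (x q)) ?gtr0_norm ?subr_gt0; lra.
apply: (@le_trans _ _ (trunc_var c (x q) (map x (r :: l)))); last first.
  by rewrite lerDr excess_ge0.
move: pqr pq; rewrite /extremum map_cons => /orP[] /andP[h1 h2].
  rewrite distrC gtr0_norm ?subr_gt0 // gtr0_norm ?subr_gt0 // => h3.
  by apply: trunc_var_far_down; lra.
rewrite gtr0_norm ?subr_gt0 // distrC gtr0_norm ?subr_gt0 // => h3.
by apply: trunc_var_far_up; lra.
Qed.

Lemma half_cycles_recS n (p : I) l : half_cycles_rec x n.+1 (p :: l) =
  if extract x (p :: l) is Some (h, l') then [:: h, h & half_cycles_rec x n l']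
  else zip (p :: l) l.
Proof. by []. Qed.

Lemma sum_half_cycles_rec c n p l : 0 <= c -> (size (p :: l) <= n)%N ->
  zigzag x (p :: l) ->
  \sum_(h <- half_cycles_rec x n (p :: l)) excess c (depth x h) =
    trunc_var c (x p) (map x l).
Proof.
move=> c0; elim: n p l => [//|n IH] p l sz zz.
rewrite half_cycles_recS; case E : extract => [[h l2]|]; last first.
  exact: trunc_var_residual.
have [H zz2 szE [q [r [m [r' [m' [[<- em] el2 _]]]]]]] := extract_spec zz E.
rewrite !big_cons el2 IH -?el2 //; last first.
  by move: sz; rewrite szE !ltnS => /ltnW.
have := H c (x p) c0; rewrite el2 map_cons !trunc_var_dup // => ->.
by rewrite addrA mulr2n.
Qed.

Lemma size_half_cycles_rec n p l : (size (p :: l) <= n)%N -> zigzag x (p :: l) ->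
  size (half_cycles_rec x n (p :: l)) = size l.
Proof.
elim: n p l => [//|n IH] p l sz zz.
rewrite half_cycles_recS; case E : extract => [[h l2]|]; last first.
  by rewrite size_zip /= (minn_idPr (leqnSn _)).
have [H zz2 szE [q [r [m [r' [m' [[<- em] el2 _]]]]]]] := extract_spec zz E.
rewrite /= el2 IH -?el2 //; last by move: sz; rewrite szE !ltnS => /ltnW.
by move: szE; rewrite el2 /= => -[] ->.
Qed.

Lemma turning_pointsP a s : exists l,
  [/\ turning_points x (a :: s) = a :: l, (size l <= size s)%N, zigzag x (a :: l) &
      forall c, 0 <= c -> trunc_var c (x a) (map x l) = trunc_var c (x a) (map x s)].
Proof.
exists (turning_from x a (merge_from x a s)); split.
- by [].
- exact: leq_trans (size_turning_from _ _ _) (size_merge_from _ _ _).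
- have := merge_from_path x a s; case: merge_from => // b l pth.
  have ab : (x a <= x a < x b) || (x b < x a <= x a).
    by rewrite lexx andbT -neq_lt eq_sym; case/andP: pth.
  by have [z [r [-> zz _]]] := zigzag_turning pth ab.
- move=> c c0.
  have dup L : trunc_var c (x a) (map x (a :: L)) = trunc_var c (x a) (map x L).
    by rewrite map_cons trunc_var_dup.
  rewrite -[LHS]dup -[RHS]dup -[RHS]trunc_var_merge //.
  have := merge_from_path x a s; case: merge_from => // b l pth.
  by apply: trunc_var_turning => //; rewrite /between lexx andbT; exact: le_total.
Qed.

Lemma sum_half_cycles c a s : 0 <= c ->
  \sum_(h <- half_cycles x (a :: s)) excess c (depth x h) =
    trunc_var c (x a) (map x s).
Proof.
move=> c0; have [l [E _ zz h]] := turning_pointsP a s.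
by rewrite /half_cycles E sum_half_cycles_rec // h.
Qed.

(** No half-cycle is lost when the columns of the incidence matrix are limited to
the number of steps. *)
Lemma size_half_cycles a s : (size (half_cycles x (a :: s)) <= size s)%N.
Proof.
have [l [E sz zz _]] := turning_pointsP a s.
by rewrite /half_cycles E size_half_cycles_rec.
Qed.

End HalfCycleSums.

Section SquareSums.
Context {R : realFieldType}.
Implicit Types (F : R -> R) (z y : R) (zs : seq R).

(** Twice the integral of [F] by the trapezoid rule with knots [z :: zs].  It is
exact for truncations whose corner is a knot. *)
Fixpoint trapezoid F z zs : R :=
  if zs is z1 :: zs' then (F z + F z1) * (z1 - z) + trapezoid F z1 zs' else 0.

(** On each interval up to [|y|] the trapezoid is a difference of two squares, and
these telescope. *)
Lemma trapezoid_excess y z zs : path <=%R z zs -> `|y| <= z \/ `|y| \in z :: zs ->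
  trapezoid (fun c => excess c y) z zs = excess z y ^+ 2.
Proof.
elim: zs z => [|z1 zs IH] z /=.
  move=> _ [yz|]; first by rewrite excess_small // expr0n.
  by rewrite inE => /eqP yz; rewrite excess_small ?yz // expr0n.
move=> /andP[zz1 pth] h.
have [yz|zy] := leP `|y| z.
  rewrite IH //; last by left; exact: le_trans zz1.
  rewrite !excess_small ?expr0n /= ?addr0 ?mul0r //; exact: le_trans zz1.
have yin : `|y| \in z1 :: zs.
  case: h => [|]; first by rewrite leNgt zy.
  by rewrite in_cons (gt_eqF zy).
have z1y : z1 <= `|y|.
  move: yin; rewrite in_cons => /orP[/eqP -> //|yin].
  by have /allP/(_ _ yin) := order_path_min le_trans pth.
rewrite IH //; last by right.
rewrite /excess !max_r ?subr_ge0 ?(ltW zy) //; ring.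
Qed.

Lemma trapezoidD F G z zs :
  trapezoid (fun c => F c + G c) z zs = trapezoid F z zs + trapezoid G z zs.
Proof. by elim: zs z => [|z1 zs IH] z /=; [rewrite addr0|rewrite IH; ring]. Qed.

Lemma trapezoidZ a F z zs : trapezoid (fun c => a * F c) z zs = a * trapezoid F z zs.
Proof. by elim: zs z => [|z1 zs IH] z /=; [rewrite mulr0|rewrite IH; ring]. Qed.

Lemma trapezoid_sum (J : Type) (r : seq J) (F : J -> R -> R) z zs :
  trapezoid (fun c => \sum_(j <- r) F j c) z zs = \sum_(j <- r) trapezoid (F j) z zs.
Proof.
elim: r => [|j r IH].
  rewrite big_nil; elim: zs z => [//|z1 zs IH] z.
  by rewrite /= IH !big_nil !addr0 mul0r.
rewrite big_cons -IH -trapezoidD; congr trapezoid.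
by apply/funext => c; rewrite big_cons.
Qed.

Lemma le_trapezoid F G z zs : path <=%R z zs ->
  (forall c, z <= c -> F c <= G c) -> trapezoid F z zs <= trapezoid G z zs.
Proof.
elim: zs z => //= z1 zs IH z /andP[zz1 pth] FG.
apply: lerD; last by apply: IH => // c z1c; apply: FG; exact: le_trans z1c.
by apply: ler_wpM2r; [rewrite subr_ge0|apply: lerD; apply: FG].
Qed.

(** This is weak majorization: a square is a combination, with nonnegative
weights, of truncations at the knots. *)
Lemma sum_sqr_le (s t : R) (D D1 D2 : seq R) :
  (forall c, 0 <= c -> \sum_(y <- D) excess c y <=
     s * (\sum_(y <- D1) excess c y) + t * (\sum_(y <- D2) excess c y)) ->
  \sum_(y <- D) y ^+ 2 <= s * (\sum_(y <- D1) y ^+ 2) + t * (\sum_(y <- D2) y ^+ 2).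
Proof.
move=> h.
(* With all depths as knots, the rule integrates every truncation exactly. *)
pose zs := sort <=%R (map Num.norm (D ++ D1 ++ D2)).
have pth : path <=%R 0 zs.
  rewrite path_min_sorted ?sort_sorted //; first exact: le_total.
  by apply/allP => z; rewrite mem_sort => /mapP[y _ ->]; exact: normr_ge0.
have sqrE (L : seq R) : {subset L <= D ++ D1 ++ D2} ->
    \sum_(y <- L) y ^+ 2 = trapezoid (fun c => \sum_(y <- L) excess c y) 0 zs.
  move=> sub; rewrite trapezoid_sum !big_seq; apply: eq_bigr => y yL.
  rewrite trapezoid_excess //; last first.
    by right; rewrite in_cons mem_sort map_f ?orbT //; exact: sub.
  by rewrite /excess subr0 max_r ?normr_ge0 // real_normK // num_real.
rewrite !sqrE; first last.
- by move=> y yD; rewrite !mem_cat yD.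
- by move=> y yD; rewrite !mem_cat yD orbT.
- by move=> y yD; rewrite !mem_cat yD !orbT.
rewrite -!trapezoidZ -trapezoidD; exact: le_trapezoid.
Qed.

Lemma sum_sqr_depth_convex (I : Type) (x y : I -> R) (s t : R) a (l : seq I) :
  0 <= s -> 0 <= t -> s + t = 1 ->
  \sum_(h <- half_cycles (fun i => s * x i + t * y i) (a :: l))
      depth (fun i => s * x i + t * y i) h ^+ 2 <=
    s * (\sum_(h <- half_cycles x (a :: l)) depth x h ^+ 2) +
    t * (\sum_(h <- half_cycles y (a :: l)) depth y h ^+ 2).
Proof.
move=> s0 t0 st; set z := fun i => _.
rewrite -(big_map (depth z) xpredT (fun y => y ^+ 2)).
rewrite -(big_map (depth x) xpredT (fun y => y ^+ 2)).
rewrite -(big_map (depth y) xpredT (fun y => y ^+ 2)).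
apply: sum_sqr_le => c c0; rewrite !big_map !sum_half_cycles //.
exact: trunc_var_convex.
Qed.

End SquareSums.

(** * The degradation cost is convex and homogeneous *)

Section Comparisons.
Context {R : realFieldType} {I : Type}.
Implicit Types (x y : I -> R) (s l : seq I).

(** All decisions of the rainflow algorithm, including those on absolute values
of differences, are determined by these comparisons. *)
Definition same_comparisons x y : Prop :=
  forall a b d e, (x a - x b <= x d - x e) = (y a - y b <= y d - y e).

Variables (x y : I -> R) (xy : same_comparisons x y).

Lemma same_le a b : (x a <= x b) = (y a <= y b).
Proof. by have := xy a b a a; rewrite !subrr !subr_le0. Qed.

Lemma same_lt a b : (x a < x b) = (y a < y b).
Proof. by rewrite !ltNge same_le. Qed.

Lemma same_eq a b : (x a == x b) = (y a == y b).
Proof. by rewrite !eq_le !same_le. Qed.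

Lemma same_dist a b d e :
  (`|x a - x b| <= `|x d - x e|) = (`|y a - y b| <= `|y d - y e|).
Proof.
have distE (z : I -> R) i j : `|z i - z j| = if z j <= z i then z i - z j else z j - z i.
  by case: leP => h; [rewrite ger0_norm ?subr_ge0|rewrite ltr0_norm ?subr_lt0 ?opprB].
by rewrite !distE !same_le; case: ifP => _; case: ifP => _; rewrite xy.
Qed.

Lemma same_half_cycles s : half_cycles x s = half_cycles y s.
Proof.
have mergeE l b : merge_from x b l = merge_from y b l.
  by elim: l b => //= d l IH b; rewrite same_eq !IH.
have turnE l b : turning_from x b l = turning_from y b l.
  elim: l b => [//|b [//|d l] IH] a.
  by rewrite !turning_from_cons IH /extremum !same_lt.
have extractE l : extract x l = extract y l.
  elim: l => [//|p [//|q [//|r [//|t l]]] IH].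
  by rewrite !extract_cons IH /inner_cycle !same_dist.
have recE n l : half_cycles_rec x n l = half_cycles_rec y n l.
  by elim: n l => [//|n IH] l /=; rewrite extractE; case: extract => [[c l']|]; rewrite ?IH.
rewrite /half_cycles recE /turning_points.
have -> : merge_equal x s = merge_equal y s by case: s => //= b l; rewrite mergeE.
by case: merge_equal => // b l; rewrite turnE.
Qed.

Lemma same_sorted_half_cycles s : sorted_half_cycles x s = sorted_half_cycles y s.
Proof.
rewrite /sorted_half_cycles same_half_cycles; congr (sort _ _).
by apply/funext => h; apply/funext => h'; rewrite /depth same_dist.
Qed.

Lemma same_orient h : orient x h = orient y h.
Proof. by rewrite /orient same_lt. Qed.

End Comparisons.

Section Dot.
Context {R : realType} {T : nat}.
Implicit Types (u v w : 'cV[R]_T).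

Lemma dotE u v : dot u v = \sum_i u i ord0 * v i ord0.
Proof. by rewrite /dot mxE; apply: eq_bigr => i _; rewrite mxE. Qed.

Lemma dotC u v : dot u v = dot v u.
Proof. by rewrite !dotE; apply: eq_bigr => i _; rewrite mulrC. Qed.

Lemma dotDr u v w : dot u (v + w) = dot u v + dot u w.
Proof. by rewrite /dot mulmxDr mxE. Qed.

Lemma dotZr a u v : dot u (a *: v) = a * dot u v.
Proof. by rewrite /dot -scalemxAr mxE. Qed.

Lemma dotDl u v w : dot (v + w) u = dot v u + dot w u.
Proof. by rewrite dotC dotDr !(dotC u). Qed.

Lemma dotZl a u v : dot (a *: u) v = a * dot u v.
Proof. by rewrite dotC dotZr dotC. Qed.

Lemma dotNr u v : dot u (- v) = - dot u v.
Proof. by rewrite -scaleN1r dotZr mulN1r. Qed.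

Lemma dotBr u v w : dot u (v - w) = dot u v - dot u w.
Proof. by rewrite dotDr dotNr. Qed.

Lemma dotBl u v w : dot (v - w) u = dot v u - dot w u.
Proof. by rewrite dotC dotBr !(dotC u). Qed.

Lemma dot_sumr (J : Type) (r : seq J) (P : pred J) u (F : J -> 'cV[R]_T) :
  dot u (\sum_(j <- r | P j) F j) = \sum_(j <- r | P j) dot u (F j).
Proof.
elim/big_rec2: _ => [|j y1 y2 _ <-]; last by rewrite dotDr.
by rewrite /dot mulmx0 mxE.
Qed.

Lemma dot_ge0 u : 0 <= dot u u.
Proof. by rewrite dotE sumr_ge0 // => i _; rewrite -expr2 sqr_ge0. Qed.

Lemma dot_eq0 u : dot u u = 0 -> u = 0.
Proof.
rewrite dotE => /eqP; rewrite psumr_eq0; last by move=> i _; rewrite -expr2 sqr_ge0.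
move=> /allP h; apply/colP => i; rewrite [RHS]mxE.
by have := h i (mem_index_enum _); rewrite /= mulf_eq0 orbb => /eqP.
Qed.

Lemma dot_gt0 u : u <> 0 -> 0 < dot u u.
Proof.
by move=> u0; rewrite lt_def dot_ge0 andbT; apply/eqP => /dot_eq0.
Qed.

Lemma dot_trmx (N : 'M[R]_T) u v : dot u (N^T *m N *m v) = dot (N *m u) (N *m v).
Proof. by rewrite /dot trmx_mul !mulmxA. Qed.

End Dot.

Section Degradation.
Context {R : realType} {T : nat}.
Implicit Types (E : R) (u v w : 'cV[R]_T).

Lemma incidence_same (x y : 'cV[R]_T.+1) :
  same_comparisons (fun t => x t ord0) (fun t => y t ord0) -> incidence x = incidence y.
Proof.
move=> xy; rewrite /incidence /sorted_cycles (same_sorted_half_cycles xy).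
have -> // : orient (fun t => x t ord0) = orient (fun t => y t ord0).
by apply/funext => h; apply: same_orient.
Qed.

Lemma degradation_mx_pscale E k u : 0 < k ->
  degradation_mx E (k *: u) = degradation_mx E u.
Proof.
move=> k0; rewrite /degradation_mx.
suff -> : incidence (soc_profile E (k *: u)) = incidence (soc_profile E u) by [].
apply: incidence_same => a b d e.
have scale t : soc_profile E (k *: u) t ord0 = k * soc_profile E u t ord0.
  rewrite !mxE mulrCA; congr (_ * _); rewrite mulr_sumr.
  by apply: eq_bigr => i _; rewrite mxE.
by rewrite !scale -!mulrBr ler_pM2l.
Qed.

Lemma degradation_mx_capacity E E' u : 0 < E -> 0 < E' ->
  degradation_mx E u = (E' / E) *: degradation_mx E' u.
Proof.
move=> E0 E0'; rewrite /degradation_mx scalerA.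
have -> : E' / E * - E'^-1 = - E^-1 by field; rewrite !gt_eqF.
suff -> : incidence (soc_profile E u) = incidence (soc_profile E' u) by [].
apply: incidence_same => a b d e.
have scale t : soc_profile E u t ord0 = (E' / E) * soc_profile E' u t ord0.
  by rewrite !mxE; field; rewrite !gt_eqF.
by rewrite !scale -!mulrBr ler_pM2l // divr_gt0.
Qed.

Definition degradation E u : R := degradation_form E u u.

Lemma degradationE E u :
  degradation E u = dot (degradation_mx E u *m u) (degradation_mx E u *m u).
Proof. by rewrite /degradation /degradation_form dot_trmx. Qed.

Lemma degradation_ge0 E u : 0 <= degradation E u.
Proof. by rewrite degradationE dot_ge0. Qed.

Lemma degradation_scale E k u : 0 <= k ->
  degradation E (k *: u) = k ^+ 2 * degradation E u.
Proof.
rewrite le_eqVlt => /orP[/eqP <-|k0]; rewrite !degradationE.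
  by rewrite expr2 mul0r [RHS]mul0r scale0r mulmx0; rewrite /dot mulmx0 mxE.
by rewrite degradation_mx_pscale // -scalemxAr dotZl dotZr mulrA.
Qed.

Lemma degradation_capacity E E' u : 0 < E -> 0 < E' ->
  degradation E u = (E' / E) ^+ 2 * degradation E' u.
Proof.
move=> E0 E0'; rewrite !degradationE (degradation_mx_capacity _ E0 E0').
by rewrite -scalemxAl dotZl dotZr mulrA.
Qed.

(** At [u] itself the quadratic form of [N(u)] is the squared norm of the vector
of depths, which are those of the list of half-cycles, padded with zeros. *)
Lemma degradation_sum_depth E u : let x t := soc_profile E u t ord0 in
  degradation E u = \sum_(h <- half_cycles x (enum 'I_T.+1)) depth x h ^+ 2.
Proof.
move=> x; rewrite degradationE degradation_mx_rainflow dotE.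
have szE : (size (sorted_cycles (soc_profile E u)) <= T)%N.
  rewrite /sorted_cycles /sorted_half_cycles size_sort enum_ordSl.
  by apply: leq_trans (size_half_cycles _ _ _) _; rewrite size_map size_enum_ord.
rewrite -[RHS](perm_big _ (permEl (perm_sort (fun c c' => depth x c' <= depth x c) _))) /=.
rewrite -[sort _ _]/(sorted_cycles (soc_profile E u)).
set cs := sorted_cycles _ in szE *.
rewrite (big_nth (ord0, ord0)) big_mkord.
rewrite (big_ord_widen T (fun k => depth x (nth (ord0, ord0) cs k) ^+ 2)) //.
  rewrite [RHS]big_mkcond /=; apply: eq_bigr => k _; rewrite !mxE -expr2 -/cs -/x.
  case: ifPn => [kc|]; first by rewrite (nth_map (ord0, ord0)).
  by rewrite -leqNgt => kc; rewrite nth_default ?size_map // expr0n.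
Qed.

Lemma soc_profileD E s t u v i :
  soc_profile E (s *: u + t *: v) i ord0 =
    s * soc_profile E u i ord0 + t * soc_profile E v i ord0.
Proof.
rewrite !mxE !(mulrCA _ (- E^-1)) -mulrDr; congr (_ * _).
by rewrite !mulr_sumr -big_split /=; apply: eq_bigr => k _; rewrite !mxE.
Qed.

Lemma degradation_convex E s t u v : 0 <= s -> 0 <= t -> s + t = 1 ->
  degradation E (s *: u + t *: v) <= s * degradation E u + t * degradation E v.
Proof.
move=> s0 t0 st; rewrite !degradation_sum_depth enum_ordSl.
have -> : (fun i => soc_profile E (s *: u + t *: v) i ord0) =
   (fun i => s * soc_profile E u i ord0 + t * soc_profile E v i ord0).
  by apply/funext => i; apply: soc_profileD.
exact: sum_sqr_depth_convex.
Qed.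

End Degradation.

(** * Closures, continuity and Gordan's alternative *)

Section Closure.

(** A pigeonhole principle for limits: a point approached through finitely many
sets is approached through one of them. *)
Lemma closure_finite_cover (X : topologicalType) (I : choiceType) (A : set I)
    (F : I -> set X) (B : set X) (x : X) :
  finite_set A -> B `<=` \bigcup_(i in A) F i -> closure B x ->
  exists2 i, A i & closure (F i) x.
Proof.
move=> finA BF Bx.
have cl : closed (\bigcup_(i in A) closure (F i)).
  by apply: closed_bigcup => // i _; apply: closed_closure.
apply: cl; apply: closureS Bx => y /BF[i Ai Fiy].
by exists i => //; apply: subset_closure.
Qed.

Lemma closure_le (R : realType) (X : topologicalType) (f g : X -> R) (B : set X) (x : X) :
  continuous f -> continuous g -> (forall y, B y -> f y <= g y) -> closure B x ->
  f x <= g x.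
Proof.
move=> cf cg fg Bx; rewrite -subr_ge0.
have cl : closed [set y | 0 <= g y - f y].
  apply: (@preimage_closed X R (fun y => g y - f y) [set z | 0 <= z]).
    by move=> y _; apply: cvgB; [exact: cg|exact: cf].
  exact: closed_ge.
by apply: cl; apply: closureS Bx => y /fg; rewrite /= subr_ge0.
Qed.

Lemma closure_image (X Y : topologicalType) (f : X -> Y) (A : set X) (B : set Y) (x : X) :
  continuous f -> (forall y, A y -> B (f y)) -> closure A x -> closure B (f x).
Proof.
move=> cf AB Ax U /cf fU; have [y [Ay Uy]] := Ax _ fU.
by exists (f y); split => //; apply: AB.
Qed.

End Closure.

Section Continuity.
Context {R : realType} {X : topologicalType}.

Lemma continuous_const (Y : topologicalType) (y : Y) : continuous (fun _ : X => y).
Proof. by move=> x; apply: cvg_cst. Qed.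

Lemma continuous_idf : continuous (fun x : X => x).
Proof. by move=> x; apply: cvg_id. Qed.

Lemma continuous_add (V : normedModType R) (f g : X -> V) :
  continuous f -> continuous g -> continuous (fun x => f x + g x).
Proof. by move=> cf cg x; apply: cvgD; [exact: cf|exact: cg]. Qed.

Lemma continuous_sub (V : normedModType R) (f g : X -> V) :
  continuous f -> continuous g -> continuous (fun x => f x - g x).
Proof. by move=> cf cg x; apply: cvgB; [exact: cf|exact: cg]. Qed.

Lemma continuous_scale (V : normedModType R) (f : X -> R) (g : X -> V) :
  continuous f -> continuous g -> continuous (fun x => f x *: g x).
Proof. by move=> cf cg x; apply: cvgZ; [exact: cf|exact: cg]. Qed.

Lemma continuous_mul (f g : X -> R) :
  continuous f -> continuous g -> continuous (fun x => f x * g x).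
Proof. by move=> cf cg x; apply: cvgM; [exact: cf|exact: cg]. Qed.

Lemma continuous_sum (I : Type) (r : seq I) (P : pred I) (F : I -> X -> R) :
  (forall i, continuous (F i)) -> continuous (fun x => \sum_(i <- r | P i) F i x).
Proof.
move=> cF; elim: r => [|i r IH] x.
  have -> : (fun x => \sum_(i <- [::] | P i) F i x) = fun=> 0.
    by apply/funext => y; rewrite big_nil.
  exact: cvg_cst.
have -> : (fun x => \sum_(i <- i :: r | P i) F i x) =
    (fun x => (if P i then F i x else 0) + \sum_(i <- r | P i) F i x).
  by apply/funext => y; rewrite big_cons; case: ifP; rewrite ?add0r.
apply: cvgD; last exact: IH.
by case: (P i); [exact: cF|exact: cvg_cst].
Qed.

Lemma continuous_dot T (f g : X -> 'cV[R]_T) : continuous f -> continuous g ->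
  continuous (fun x => dot (f x) (g x)).
Proof.
move=> cf cg; under eq_fun do rewrite dotE.
apply: continuous_sum => i x; apply: cvgM.
  by apply: (@continuous_comp X _ _ f (fun M => M i ord0)); [exact: cf|exact: coord_continuous].
by apply: (@continuous_comp X _ _ g (fun M => M i ord0)); [exact: cg|exact: coord_continuous].
Qed.

Lemma continuous_dot_mulmx T (N : 'M[R]_T) (f g : X -> 'cV[R]_T) :
  continuous f -> continuous g ->
  continuous (fun x => dot (N *m f x) (N *m g x)).
Proof.
move=> cf cg; under eq_fun do rewrite dotE.
have cN (h : X -> 'cV[R]_T) i : continuous h -> continuous (fun x => (N *m h x) i ord0).
  move=> ch; under eq_fun do rewrite mxE.
  apply: continuous_sum => j x; apply: cvgM; first exact: cvg_cst.
  by apply: (@continuous_comp X _ _ h (fun M => M j ord0)); [exact: ch|exact: coord_continuous].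
by apply: continuous_sum => i x; apply: cvgM; apply: cN.
Qed.

End Continuity.

Section Gordan.
Context {R : realType} {T : nat}.

Lemma small_perturbation (J : eqType) (r : seq J) (p q : J -> R) :
  (forall j, j \in r -> p j < 0) ->
  exists2 e, 0 < e & forall j, j \in r -> p j + e * q j < 0.
Proof.
elim: r => [|j r IH] h; first by exists 1.
have [i ir|e e0 he] := IH; first by apply: h; rewrite in_cons ir orbT.
have pj : p j < 0 by apply: h; rewrite mem_head.
pose e' := Num.min e (- p j / (2 * (1 + `|q j|))).
have den : 0 < 2 * (1 + `|q j|) by have := normr_ge0 (q j); lra.
have e'0 : 0 < e' by rewrite lt_min e0 divr_gt0 // oppr_gt0.
exists e' => // i; rewrite in_cons => /orP[/eqP ->|ir].
  have e'j : e' * (2 * (1 + `|q j|)) <= - p j.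
    by rewrite -ler_pdivlMr // ge_min lexx orbT.
  have : e' * q j <= e' * `|q j| by rewrite ler_pM2l // ler_norm.
  have : 0 <= e' * `|q j| by rewrite mulr_ge0 ?normr_ge0 // ltW.
  lra.
have := he i ir; have := h i; rewrite in_cons ir orbT => /(_ isT) pi0.
have e'e : e' <= e by rewrite ge_min lexx.
have [qi|qi] := leP 0 (q i).
  have : e' * q i <= e * q i by rewrite ler_wpM2r.
  lra.
have : e' * q i < 0 by rewrite pmulr_rlt0.
lra.
Qed.

(** Either [0] is a convex combination of the vectors, or they all lie in an open
half space.  By induction: if the half space [h] for the remaining vectors does
not suit the first vector [f j0], project the others along [f j0] onto the
hyperplane orthogonal to [h] and apply the induction hypothesis again; if
[f j0] is itself orthogonal to [h], a small tilt of [h] is enough. *)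
Lemma gordan_alternative (J : eqType) (r : seq J) (f : J -> 'cV[R]_T) : uniq r ->
  (exists gamma : J -> R, [/\ forall j, j \in r -> 0 <= gamma j,
     \sum_(j <- r) gamma j = 1 & \sum_(j <- r) gamma j *: f j = 0]) \/
  (exists h, forall j, j \in r -> dot (f j) h < 0).
Proof.
elim: r f => [|j0 r IH] f; first by right; exists 0.
move=> /= /andP[j0r ur].
have ext (a : R) (gamma : J -> R) : let gamma' j := if j == j0 then a else gamma j in
    [/\ \sum_(j <- j0 :: r) gamma' j = a + \sum_(j <- r) gamma j,
      \sum_(j <- j0 :: r) gamma' j *: f j = a *: f j0 + \sum_(j <- r) gamma j *: f j &
      0 <= a -> (forall j, j \in r -> 0 <= gamma j) ->
        forall j, j \in j0 :: r -> 0 <= gamma' j].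
  have ne j : j \in r -> (j == j0) = false.
    by move=> jr; apply/negbTE; apply: contraNneq j0r => <-.
  split.
  - rewrite big_cons eqxx; congr (_ + _); rewrite !big_seq.
    by apply: eq_bigr => j /ne ->.
  - rewrite big_cons eqxx; congr (_ + _); rewrite !big_seq.
    by apply: eq_bigr => j /ne ->.
  - move=> a0 g0 j; rewrite in_cons => /orP[->//|jr].
    by rewrite (ne _ jr); apply: g0.
have [f00|f00] := eqVneq (f j0) 0.
  left; have [s1 s2 s3] := ext 1 (fun=> 0).
  exists (fun j => if j == j0 then 1 else 0); split; first exact: s3.
    by rewrite s1 big1 ?addr0.
  by rewrite s2 f00 scaler0 add0r big1 // => j _; rewrite scale0r.
have [[gamma [g0 g1 gf]]|[h hr]] := IH f ur.
  left; have [s1 s2 s3] := ext 0 gamma.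
  exists (fun j => if j == j0 then 0 else gamma j); split; first exact: s3.
    by rewrite s1 add0r.
  by rewrite s2 scale0r add0r.
set a0 := dot (f j0) h.
have [a0n|a0p|a00] := ltgtP a0 0.
- by right; exists h => j; rewrite in_cons => /orP[/eqP ->//|/hr].
(* The combination of the projections is one of the vectors themselves, with
   the weight [w0] on [f j0], once divided by the total weight. *)
- have [[gamma [g0 g1 gf]]|[k kr]] := IH (fun j => a0 *: f j - dot (f j) h *: f j0) ur.
    left; pose w0 := \sum_(j <- r) gamma j * - dot (f j) h.
    have w00 : 0 <= w0.
      rewrite /w0 big_seq sumr_ge0 // => j jr; apply: mulr_ge0; first exact: g0.
      by rewrite oppr_ge0 ltW // hr.
    have W0 : 0 < a0 + w0 by lra.
    have [s1 s2 s3] := ext (w0 / (a0 + w0)) (fun j => a0 * gamma j / (a0 + w0)).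
    eexists; split; first apply: s3.
    + by rewrite divr_ge0 // ltW.
    + by move=> j jr; rewrite divr_ge0 ?mulr_ge0 ?g0 // ltW.
    + by rewrite s1 -mulr_suml -mulr_sumr g1 mulr1 -mulrDl addrC divff // gt_eqF.
    + rewrite s2.
      have e j : (a0 * gamma j / (a0 + w0)) *: f j =
          (a0 + w0)^-1 *: (gamma j *: (a0 *: f j)).
        by rewrite !scalerA; congr (_ *: _); ring.
      under eq_bigr do rewrite e.
      rewrite -scaler_sumr mulrC -scalerA -scalerDr -[RHS](scaler0 _ (a0 + w0)^-1).
      congr (_ *: _); rewrite -[RHS]gf.
      under [RHS]eq_bigr do rewrite scalerBr.
      rewrite sumrB addrC; congr (_ + _).
      rewrite /w0 scaler_suml -sumrN; apply: eq_bigr => j _.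
      by rewrite scalerA -scaleNr mulrN.
  right; pose b0 := dot (f j0) k.
  (* [a0 *: k - b0 *: h] is orthogonal to [f j0] and negative on the others; a
     small multiple of [h] tilts it to the negative side of [f j0]. *)
  have [j|e e0 he] := @small_perturbation J r
    (fun j => a0 * dot (f j) k - b0 * dot (f j) h) (fun j => - dot (f j) h).
    move=> /kr; rewrite dotBl !dotZl -/b0 (mulrC b0); lra.
  exists (a0 *: k - b0 *: h - e *: h) => j; rewrite in_cons !dotBr !dotZr.
  case/orP => [/eqP ->|/he]; last by rewrite mulrN.
  rewrite -/a0 -/b0; have : 0 < e * a0 by rewrite mulr_gt0.
  lra.
- right; have [j|e e0 he] := @small_perturbation J r
    (fun j => dot (f j) h) (fun j => - dot (f j) (f j0)); first exact: hr.
  exists (h - e *: f j0) => j; rewrite in_cons dotBr dotZr.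
  case/orP => [/eqP ->|/he]; last by rewrite mulrN.
  rewrite -/a0 a00 sub0r oppr_lt0 mulr_gt0 //; apply: dot_gt0; exact/eqP.
Qed.

End Gordan.

(** * Gradients of the pieces and subgradients of the cost *)

Section LocallyConstant.
Context {R : realType} {T : nat} (E : R).
Implicit Types (u v w d h : 'cV[R]_T) (N : 'M[R]_T).

Definition locally_constant_at w : Prop :=
  \forall w' \near w, degradation_mx E w' = degradation_mx E w.

Lemma continuous_soc_profile t :
  continuous (fun u : 'cV[R]_T => soc_profile E u t ord0).
Proof.
under eq_fun do rewrite mxE.
apply: continuous_mul; first exact: continuous_const.
apply: (@continuous_sum _ _ _ _ _ (fun i (v : 'cV[R]_T) => v i ord0)) => i.
exact: coord_continuous.
Qed.

(** The functionals whose signs determine the degradation matrix. *)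
Definition comparison (q : ('I_T.+1 * 'I_T.+1) * ('I_T.+1 * 'I_T.+1)) u : R :=
  let x t := soc_profile E u t ord0 in x q.1.1 - x q.1.2 - (x q.2.1 - x q.2.2).

Lemma continuous_comparison q : continuous (comparison q).
Proof.
by rewrite /comparison; do 2 apply: continuous_sub; apply: continuous_soc_profile.
Qed.

Lemma comparison_degradation_mx v w :
  (forall q, (comparison q v <= 0) = (comparison q w <= 0)) ->
  degradation_mx E v = degradation_mx E w.
Proof.
move=> vw; rewrite /degradation_mx.
suff -> : incidence (soc_profile E v) = incidence (soc_profile E w) by [].
apply: incidence_same => a b e f.
by have := vw ((a, b), (e, f)); rewrite /comparison !subr_le0.
Qed.

(** In any open set take a point where as few of the comparisons as possible are
ties.  Nearby strict comparisons persist, and no tie can be broken because the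
number of ties is minimal, so all outcomes are constant nearby. *)
Lemma locally_constant_dense u : closure locally_constant_at u.
Proof.
move=> U; rewrite nbhsE => -[B [oB Bu] BU].
pose ties w := [set q | comparison q w == 0]%SET.
pose P n := `[< exists2 w, B w & #|ties w| = n >].
have exP : exists n, P n by exists #|ties u|; apply/asboolP; exists u.
have [n /asboolP[w Bw <-] minw] := ex_minnP exP.
exists w; split; last exact: BU.
have nB : \forall w' \near w, B w' by apply: open_nbhs_nbhs.
pose keeps_sign q w' := comparison q w != 0 ->
  comparison q w' != 0 /\ (comparison q w' <= 0) = (comparison q w <= 0).
have nsign q : \forall w' \near w, keeps_sign q w'.
  rewrite /keeps_sign.
  have [q0|] := eqVneq (comparison q w) 0; first by apply: filterE => w'.
  rewrite neq_lt => /orP[q0|q0].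
    have : \forall w' \near w, comparison q w' < 0.
      exact: (@continuous_comparison q w _ (lt_nbhsl q0)).
    apply: filterS => w' w'0 _; split; first by rewrite lt_eqF.
    by rewrite !ltW.
  have : \forall w' \near w, 0 < comparison q w'.
    exact: (@continuous_comparison q w _ (lt_nbhsr q0)).
  apply: filterS => w' w'0 _; split; first by rewrite gt_eqF.
  by rewrite !leNgt q0 w'0.
have nsigns : \forall w' \near w, forall q, keeps_sign q w'
  by exact: (@filter_forall _ _ keeps_sign (nbhs w) _ nsign).
suff key w' : B w' -> (forall q, keeps_sign q w') ->
    degradation_mx E w' = degradation_mx E w.
  by apply: filterS (filterI nB nsigns) => w' [Bw' sgn]; exact: key.
move=> Bw' sgn; apply: comparison_degradation_mx.
have sub : ties w' \subset ties w.
  apply/fintype.subsetP => q; rewrite !inE; apply: contraTT => /sgn[]//.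
have tiesE : ties w' = ties w.
  apply/eqP; rewrite eqEcard sub /=; apply: minw.
  by apply/asboolP; exists w'.
move=> q; have [q0|qn0] := eqVneq (comparison q w) 0; last by case: (sgn q qn0).
have : q \in ties w' by rewrite tiesE inE q0.
by rewrite inE => /eqP ->; rewrite q0.
Qed.

(** The matrices take finitely many values, so convergence of matrices means that
they are eventually equal to the limit. *)
Lemma associated_mxP u N :
  associated_mx E u N <-> closure [set w | locally_constant_at w /\ degradation_mx E w = N] u.
Proof.
split=> [[v [vu vreg vN]] U Uu|clo].
  have finF := finite_range_degradation_mx E (R := R) (T := T).
  have nN : \forall n \near \oo, degradation_mx E (v n) = N.
    pose F' := range (@degradation_mx R T E) `\ N.
    have cl : closed F'.
      have [+ _] := @accessible_finite_set_closed 'M[R]_T; apply.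
        exact/hausdorff_accessible/norm_hausdorff.
      by apply: sub_finite_set finF => M [].
    have nbN : nbhs N (~` F').
      apply: open_nbhs_nbhs; split; first exact: closed_openC.
      by move=> [_ /(_ erefl)].
    have nF : \forall n \near \oo, (~` F') (degradation_mx E (v n)) by exact: vN nbN.
    apply: filterS nF => n nF'; apply: contrapT => neq; apply: nF'.
    by split => //; exists (v n).
  have [n [Un nE]] : exists n, U (v n) /\ degradation_mx E (v n) = N.
    by apply: (@filter_ex _ \oo); apply: filterI nN; exact: vu.
  by exists (v n); split => //; split => //; apply: vreg.
pose P (n : nat) v := [/\ locally_constant_at v, degradation_mx E v = N & ball u n.+1%:R^-1 v].
have /boolp.choice[v vP] n : exists v, P n v.
  have [|w [[? ?] ?]] := clo (ball u n.+1%:R^-1); last by exists w.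
  by apply: nbhsx_ballx; rewrite invr_gt0 ltr0n.
exists v; split.
- apply/cvg_ballP => e e0; near=> n.
  have [_ _] := vP n; apply: le_ball; apply/ltW; near: n.
  exact: near_infty_natSinv_lt (PosNum e0).
- by move=> n; have [] := vP n.
- have -> : (fun n => degradation_mx E (v n)) = fun=> N.
    by apply/funext => n; have [] := vP n.
  exact: cvg_cst.
Unshelve. all: by end_near.
Qed.

(** Near [v] the cost is the quadratic form of [N], so its gradient is
[2 N^T N v], and for a convex function a gradient is a global subgradient.
In the form below, linear in [w], the statement passes to limits of [v]. *)
Lemma locally_constant_subgradient v w (N := degradation_mx E v) : locally_constant_at v ->
  dot (N *m v) (N *m w) *+ 2 - dot (N *m v) (N *m v) <= degradation E w.
Proof.
move=> reg; pose h := w - v.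
have ct : continuous (fun t : R => v + t *: h).
  apply: continuous_add; first exact: continuous_const.
  by apply: continuous_scale; [exact: continuous_idf|exact: continuous_const].
have reg0 : nbhs (v + 0 *: h) [set w' | degradation_mx E w' = N].
  by rewrite scale0r addr0.
have [e /= e0 he] := ct 0 _ reg0.
pose t := Num.min (e / 2) (1 / 2).
have t0 : 0 < t by rewrite lt_min !divr_gt0.
have t1 : t < 1 by rewrite /t gt_min; apply/orP; right; lra.
have te : t < e by rewrite /t gt_min; apply/orP; left; lra.
have Nt : degradation_mx E (v + t *: h) = N.
  by apply: he; rewrite /= sub0r normrN gtr0_norm.
have := @degradation_convex R T E (1 - t) t v w; rewrite subrK.
move=> /(_ _ (ltW t0) erefl); rewrite subr_ge0 => /(_ (ltW t1)).
have -> : (1 - t) *: v + t *: w = v + t *: h.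
  by rewrite /h scalerBr scalerBl scale1r addrA addrAC.
rewrite !(degradationE E (_ + _)) (degradationE E v) Nt -/N mulmxDr -scalemxAr.
rewrite dotDl !dotDr !dotZl !dotZr /h !mulmxBr !dotBr !dotBl.
rewrite (dotC (N *m w) (N *m v)).
set a := dot (N *m v) (N *m v); set b := dot (N *m v) (N *m w).
set k := dot (N *m w) (N *m w) => H.
have k0 : 0 <= a - b - b + k.
  have := dot_ge0 (N *m v - N *m w).
  by rewrite dotBl !dotBr (dotC (N *m w) (N *m v)) -/a -/b -/k; lra.
rewrite mulr2n -(ler_pM2l t0).
have := mulr_ge0 (ltW t0) (mulr_ge0 (ltW t0) k0).
nra.
Qed.

(** A continuous bound of the cost that vanishes at [0]: it replaces the cost, whose
continuity is not yet established, where a limit is taken. *)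
Definition degradation_bound w : R :=
  \sum_(N <- finmap.enum_fset (fset_set (range (@degradation_mx R T E))))
     dot (N *m w) (N *m w).

Lemma degradation_le_bound w : degradation E w <= degradation_bound w.
Proof.
have Nin : degradation_mx E w \in finmap.enum_fset (fset_set (range (@degradation_mx R T E))).
  rewrite in_fset_set; last exact: finite_range_degradation_mx.
  by rewrite inE; exists w.
rewrite degradationE /degradation_bound (perm_big _ (perm_to_rem Nin)) /= big_cons.
by rewrite lerDl sumr_ge0 // => N _; apply: dot_ge0.
Qed.

Lemma continuous_degradation_bound (X : topologicalType) (f : X -> 'cV[R]_T) :
  continuous f -> continuous (fun x => degradation_bound (f x)).
Proof.
by move=> cf; apply: continuous_sum => N; apply: continuous_dot_mulmx.
Qed.

Lemma degradation_bound0 : degradation_bound 0 = 0.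
Proof. by rewrite /degradation_bound big1 // => N _; rewrite mulmx0 /dot mulmx0 mxE. Qed.

Lemma associated_subgradient d N w : associated_mx E d N ->
  dot (N *m d) (N *m w) *+ 2 - dot (N *m d) (N *m d) <= degradation E w.
Proof.
move=> /associated_mxP clo.
apply: (@closure_le R _ (fun v => dot (N *m v) (N *m w) *+ 2 - dot (N *m v) (N *m v))
  (fun=> degradation E w) _ d _ _ _ clo).
- have c : continuous (fun v => dot (N *m v) (N *m w)).
    by apply: continuous_dot_mulmx; [exact: continuous_idf|exact: continuous_const].
  under eq_fun do rewrite mulr2n.
  apply: continuous_sub; first exact: continuous_add.
  by apply: continuous_dot_mulmx; exact: continuous_idf.
- exact: continuous_const.
- by move=> v [reg <-]; apply: locally_constant_subgradient.
Qed.

(** One inequality is [associated_subgradient] at [d] itself.  The other is the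
lower semicontinuity of the cost at [d]: by convexity and homogeneity,
[(1 - t) D d <= D v + (1 - t) / t * D (d - v)], where [v] tends to [d] first
and [t] to [0] afterwards. *)
Lemma associated_degradation d N : associated_mx E d N ->
  dot (N *m d) (N *m d) = degradation E d.
Proof.
move=> dN; apply/eqP; rewrite eq_le; apply/andP; split.
  by have := associated_subgradient d dN; rewrite mulr2n addrK.
have key t : 0 < t -> t < 1 -> (1 - t) * degradation E d <= dot (N *m d) (N *m d).
  move=> t0 t1.
  have t10 : 0 < 1 - t by lra.
  have -> : dot (N *m d) (N *m d) =
      dot (N *m d) (N *m d) + (1 - t) / t * degradation_bound (d - d).
    by rewrite subrr degradation_bound0 mulr0 addr0.
  have /associated_mxP clo := dN.
  apply: (@closure_le R _ (fun=> (1 - t) * degradation E d)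
    (fun v => dot (N *m v) (N *m v) + (1 - t) / t * degradation_bound (d - v))
    _ d _ _ _ clo).
  - exact: continuous_const.
  - apply: continuous_add; first by apply: continuous_dot_mulmx; exact: continuous_idf.
    apply: continuous_mul; first exact: continuous_const.
    apply: continuous_degradation_bound.
    by apply: continuous_sub; [exact: continuous_const|exact: continuous_idf].
  - move=> v [_ <-]; rewrite -degradationE.
    have dE : d = (1 - t) *: ((1 - t)^-1 *: v) + t *: (t^-1 *: (d - v)).
      by rewrite !scalerA !divff ?gt_eqF // !scale1r addrC subrK.
    have := @degradation_convex R T E (1 - t) t ((1 - t)^-1 *: v) (t^-1 *: (d - v)).
    rewrite -dE subrK => /(_ (ltW t10) (ltW t0) erefl).
    rewrite !degradation_scale ?invr_ge0 ?(ltW t0) ?(ltW t10) // => H.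
    have := ler_wpM2l (ltW t10) H; move/le_trans; apply.
    rewrite mulrDr; apply: lerD.
      by rewrite le_eqVlt; apply/orP; left; apply/eqP; field; rewrite gt_eqF.
    have -> : (1 - t) * (t * (t^-1 ^+ 2 * degradation E (d - v))) =
        (1 - t) / t * degradation E (d - v) by field; rewrite gt_eqF.
    by rewrite ler_pM2l ?divr_gt0 //; exact: degradation_le_bound.
rewrite leNgt; apply/negP => lt.
set M := dot _ _ in key lt; set D := degradation E d in key lt.
have M0 : 0 <= M by apply: dot_ge0.
have D0 : 0 < D by lra.
(* For this [t], [(1 - t) * D] is the midpoint of [M] and [D]. *)
have := key ((D - M) / (2 * D)).
have -> : (1 - (D - M) / (2 * D)) * D = (D + M) / 2 by field; rewrite gt_eqF.
rewrite divr_gt0 ?subr_gt0 ?mulr_gt0 // => /(_ isT).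
rewrite ltr_pdivrMr ?mulr_gt0 // mul1r; lra.
Qed.

(** A subgradient of the cost at [d], even with an error quadratic in the
perturbation, is dominated along each direction [h] by the gradient of some
piece that meets [d].  Approach [d] along points [d + t h'] where the matrix is
locally constant, with [t] tending to [0] and [h'] to [h]: after division by
[t] the quadratic terms disappear in the limit. *)
Lemma directional_associated d s C h :
  (forall k, degradation E d + dot s k *+ 2 - C * dot k k <= degradation E (d + k)) ->
  exists2 N, associated_mx E d N & dot s h <= dot (N *m d) (N *m h).
Proof.
move=> sub.
pose ray (p : R * 'cV[R]_T) : 'cV[R]_T := d + p.1 *: p.2.
have cray : continuous ray.
  apply: continuous_add; first exact: continuous_const.
  by apply: continuous_scale => p; [exact: cvg_fst|exact: cvg_snd].
pose X N := [set p : R * 'cV[R]_T |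
  [/\ 0 < p.1, locally_constant_at (ray p) & degradation_mx E (ray p) = N]].
have dense : closure [set p : R * 'cV[R]_T | 0 < p.1 /\ locally_constant_at (ray p)] (0, h).
  move=> U [[U1 U2] /= [U1n U2n] U12].
  have [e e0 he] : exists2 e : R, 0 < e & forall t, `|t| < e -> U1 t.
    by case: U1n => e /= e0 he; exists e => // t te; apply: he; rewrite /= sub0r normrN.
  pose t := e / 2.
  have t0 : 0 < t by rewrite divr_gt0.
  have cinv : continuous (fun w : 'cV[R]_T => t^-1 *: (w - d)).
    apply: continuous_scale; first exact: continuous_const.
    by apply: continuous_sub; [exact: continuous_idf|exact: continuous_const].
  have Un : nbhs (d + t *: h) ((fun w => t^-1 *: (w - d)) @^-1` U2).
    apply: (cinv (d + t *: h)).
    by rewrite addrAC subrr add0r scalerA mulVf ?gt_eqF // scale1r.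
  have [w [wreg Uw]] := locally_constant_dense Un.
  exists (t, t^-1 *: (w - d)); split.
    have rayE : ray (t, t^-1 *: (w - d)) = w.
      by rewrite /ray scalerA divff ?gt_eqF // scale1r addrC subrK.
    by split; [exact: t0|rewrite rayE].
  apply: U12; split => //=; apply: he; rewrite gtr0_norm // /t; lra.
(* One matrix serves arbitrarily close to [(0, h)]. *)
have cover : [set p : R * 'cV[R]_T | 0 < p.1 /\ locally_constant_at (ray p)] `<=`
    \bigcup_(N in range (@degradation_mx R T E)) X N.
  by move=> p [p0 preg]; exists (degradation_mx E (ray p)); [exists (ray p)|split].
have [N _ XN] := closure_finite_cover (finite_range_degradation_mx E) cover dense.
have dN : associated_mx E d N.
  apply/associated_mxP.
  have -> : d = ray (0, h) by rewrite /ray scale0r addr0.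
  by apply: closure_image XN => // p [].
exists N => //.
have := @closure_le R _ (fun p : R * 'cV[R]_T => dot s p.2 *+ 2)
  (fun p => dot (N *m d) (N *m p.2) *+ 2
     + p.1 * (dot (N *m p.2) (N *m p.2) + C * dot p.2 p.2)) (X N) (0, h).
have c1 (u : 'cV[R]_T) : continuous (fun _ : R * 'cV[R]_T => u) by exact: continuous_const.
have c2 : continuous (fun p : R * 'cV[R]_T => p.2) by move=> p; exact: cvg_snd.
rewrite /= mul0r addr0 => H.
rewrite -(ler_pM2r (ltr0n R 2)) // !mulr_natr; apply: H XN.
- under eq_fun do rewrite mulr2n.
  by apply: continuous_add; apply: continuous_dot.
- under eq_fun do rewrite mulr2n.
  apply: continuous_add.
    by apply: continuous_add; apply: continuous_dot_mulmx.
  apply: continuous_mul; first by move=> p; exact: cvg_fst.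
  apply: continuous_add; first exact: continuous_dot_mulmx.
  by apply: continuous_mul; [exact: continuous_const|exact: continuous_dot].
- move=> [t k] [/= t0 _ NE]; have := sub (t *: k).
  rewrite (degradationE E (d + _)) -/(ray (t, k)) NE -(associated_degradation dN).
  rewrite /ray /= mulmxDr -scalemxAr dotDl !dotDr !dotZl !dotZr.
  rewrite (dotC (N *m k) (N *m d)).
  set a := dot (N *m d) (N *m k); set b := dot (N *m k) (N *m k).
  set f := dot s k; set g := dot k k => H2.
  rewrite -(ler_pM2l t0); nra.
Qed.

(** Gordan's alternative for the differences between the gradients and [s]; a
common direction of decrease is excluded by [directional_associated]. *)
Lemma subgradient_conv d s C :
  (forall k, degradation E d + dot s k *+ 2 - C * dot k k <= degradation E (d + k)) ->
  exists gamma : 'M[R]_T -> R,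
    [/\ forall N, associated_mx E d N -> 0 <= gamma N,
        \sum_(N \in associated_mx E d) gamma N = 1
      & \sum_(N \in associated_mx E d) gamma N *: (N^T *m N *m d) = s].
Proof.
move=> sub.
have finA := finite_associated_mx E d.
pose r : seq 'M[R]_T := finmap.enum_fset (fset_set (associated_mx E d)).
have rP N : N \in r <-> associated_mx E d N.
  by rewrite in_fset_set // inE.
have [[gamma [g0 g1 gs]]|[h hneg]] :=
    gordan_alternative (fun N => N^T *m N *m d - s) (finmap.fset_uniq (fset_set (associated_mx E d))).
  exists gamma; rewrite !fsbig_finite //; split => //.
    by move=> N /rP; apply: g0.
  move: gs => /=; under eq_bigr do rewrite scalerBr.
  rewrite sumrB -scaler_suml g1 scale1r => /eqP; rewrite subr_eq0 => /eqP.
  by [].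
have [N /rP Nr] := directional_associated h sub.
by have := hneg N Nr; rewrite dotBl dotC dot_trmx (dotC (N *m h)); lra.
Qed.

End LocallyConstant.

(** * Equilibrium bids and supporting prices *)

Section Equilibrium.
Context {R : realType} {T : nat}.
Implicit Types (lambda d u w h k : 'cV[R]_T).

Lemma sum_update (V W : zmodType) (I : finType) (F : I -> V -> W) (x : I -> V) i0 y :
  \sum_i F i (if i == i0 then y else x i) = \sum_i F i (x i) + (F i0 y - F i0 (x i0)).
Proof.
rewrite (bigD1 i0) //= eqxx [in RHS](bigD1 i0) //= addrC.
rewrite [RHS]addrC addrA subrK addrC; congr (_ + _).
by apply: eq_bigr => i /negbTE ->.
Qed.

(** If [D] vanished the objective would be unbounded, so an optimal bid exists
only for [D > 0] and is then given by the first order condition. *)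
Lemma quadratic_maximizer (L D a : R) : 0 < L -> 0 <= D ->
  maximizes_nonneg (fun x => x * L - x ^+ 2 * (D / 2)) a -> a * D = L.
Proof.
move=> L0 D0 [a0 amax].
have [D00|Dn0] := eqVneq D 0.
  have := amax (a + 1); rewrite addr_ge0 // => /(_ isT).
  by rewrite D00 mul0r !mulr0 !subr0 ler_pM2r // gerDl ler10.
have Dp : 0 < D by rewrite lt_def Dn0.
have H := amax (L / D) (divr_ge0 (ltW L0) D0).
have {}H : (a * D - L) ^+ 2 <= 0.
  have -> : (a * D - L) ^+ 2 = 2 * D * ((L / D * L - (L / D) ^+ 2 * (D / 2))
      - (a * L - a ^+ 2 * (D / 2))) by field.
  by rewrite mulr_ge0_le0 ?mulr_ge0 // subr_le0; exact: H.
by apply/eqP; rewrite -subr_eq0 -sqrf_eq0 eq_le H sqr_ge0.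
Qed.

Lemma generator_bid c lambda a : lambda <> 0 -> 0 < c ->
  maximizes_nonneg (generator_profit c lambda) a -> a * c = 1.
Proof.
move=> /dot_gt0 L0 c0 amax; set L := dot _ _ in L0.
have cL : a * (c * L) = L.
  apply: quadratic_maximizer => //; first by rewrite mulr_ge0 ?ltW.
  move: amax; rewrite /generator_profit -/L => -[a0 h]; split => // x /h.
  by rewrite !mulrA !(mulrAC _ L).
by apply: (mulIf (lt0r_neq0 L0)); rewrite mul1r -mulrA.
Qed.

Lemma storage_bid b E lambda a : lambda <> 0 -> 0 < b ->
  maximizes_nonneg (storage_profit b E lambda) a ->
  a * (b * degradation E lambda) = dot lambda lambda.
Proof.
move=> /dot_gt0 L0 b0 [a0 amax].
have profitE x : 0 <= x -> storage_profit b E lambda x =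
    x * dot lambda lambda - x ^+ 2 * (b * degradation E lambda / 2).
  rewrite le_eqVlt /storage_profit => /orP[/eqP <-|x0].
    by rewrite expr0n /= mulr0 !mul0r.
  rewrite /degradation /degradation_form degradation_mx_pscale //.
  by congr (_ - _); ring.
apply: quadratic_maximizer => //; first by rewrite mulr_ge0 ?degradation_ge0 ?ltW.
by split => // x x0; have := amax x x0; rewrite profitE // profitE.
Qed.

Lemma generation_supported c lambda g a : 0 < c -> a * c = 1 ->
  generation_cost c (a *: lambda) - dot lambda (a *: lambda) <=
  generation_cost c g - dot lambda g.
Proof.
move=> c0 ac; rewrite /generation_cost dotZl !dotZr.
have := dot_ge0 (g - a *: lambda).
rewrite dotBl !dotBr !dotZl !dotZr (dotC g lambda).
set gg := dot g g; set lg := dot lambda g; set ll := dot lambda lambda => H.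
have h1 := ler_wpM2l (ltW c0) H.
have e1 : c * (gg - a * lg - (a * lg - a * (a * ll))) =
  c * gg - 2 * lg * (a * c) + a * ll * (a * c) by ring.
have e2 : c / 2 * (a * (a * ll)) = a * ll / 2 * (a * c) by ring.
rewrite e1 ac in h1; rewrite e2 ac; lra.
Qed.

Variables (E0 : R) (d : 'cV[R]_T).

(** The optimality condition with an unspecified multiplier. *)
Definition conv_condition (s : R) : Prop :=
  exists gamma : 'M[R]_T -> R,
      [/\ forall N : 'M[R]_T, associated_mx E0 d N -> 0 <= gamma N,
          \sum_(N \in associated_mx E0 d) gamma N = 1
        & \sum_(N \in associated_mx E0 d) gamma N *: (N^T *m N *m d) = s *: d].

Lemma conv_condition_dot gamma v :
  dot v (\sum_(N \in associated_mx E0 d) gamma N *: (N^T *m N *m d)) =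
  \sum_(N \in associated_mx E0 d) gamma N * dot (N *m v) (N *m d).
Proof.
have fin := finite_associated_mx E0 d; rewrite !fsbig_finite // dot_sumr.
by apply: eq_bigr => N _; rewrite dotZr dot_trmx.
Qed.

Lemma conv_condition_degradation gamma :
  \sum_(N \in associated_mx E0 d) gamma N = 1 ->
  \sum_(N \in associated_mx E0 d) gamma N * dot (N *m d) (N *m d) = degradation E0 d.
Proof.
have fin := finite_associated_mx E0 d; rewrite !fsbig_finite // => g1.
rewrite -[RHS]mul1r -g1 mulr_suml !big_seq; apply: eq_bigr => N.
by rewrite in_fset_set // inE => /associated_degradation ->.
Qed.

(** Pairing with [d], on which all associated matrices agree in norm, determines
the multiplier. *)
Lemma conv_condition_ratio s : d <> 0 -> conv_condition s ->
  s = degradation E0 d / dot d d.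
Proof.
move=> d0 [gamma [_ g1 gs]].
have := conv_condition_degradation g1; rewrite -conv_condition_dot gs dotZr => <-.
by rewrite mulfK // gt_eqF // dot_gt0.
Qed.

(** A convex combination of subgradients is a subgradient. *)
Lemma conv_condition_supported s w : conv_condition s ->
  s * (dot d w *+ 2 - dot d d) <= degradation E0 w.
Proof.
move=> [gamma [g0 g1 gs]].
have e1 := conv_condition_dot gamma w; rewrite gs dotZr dotC in e1.
have e2 := conv_condition_dot gamma d; rewrite gs dotZr in e2.
rewrite mulrBr mulrnAr e1 e2.
have fin := finite_associated_mx E0 d; rewrite !fsbig_finite // in g1 *.
rewrite -sumrMnl -sumrB -[leRHS]mul1r -g1 mulr_suml !big_seq.
apply: ler_sum => N; rewrite in_fset_set // inE => dN.
rewrite -mulrnAr -mulrBr ler_wpM2l ?g0 // dotC.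
exact: associated_subgradient.
Qed.

(** The subgradient inequality at [d], moved to the dispatch [beta lambda] by
homogeneity and to the capacity [E] by rescaling; the bid of the storage unit
makes the multiplier equal to [1]. *)
Lemma storage_supported b E lambda kappa beta w : 0 < b -> 0 < E -> 0 < E0 ->
  lambda <> 0 -> 0 < kappa -> d = kappa *: lambda ->
  0 < beta -> beta * (b * degradation E lambda) = dot lambda lambda ->
  conv_condition (degradation E0 d / dot d d) ->
  degradation_cost b E (beta *: lambda) - dot lambda (beta *: lambda) <=
  degradation_cost b E w - dot lambda w.
Proof.
move=> b0 Ep E0p /dot_gt0 L0 k0 dE be0 opt cond.
rewrite /degradation_cost -!/(degradation _ _) (degradation_scale _ _ (ltW be0)) dotZr.
have bk : 0 < kappa / beta by rewrite divr_gt0.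
have := conv_condition_supported ((kappa / beta) *: w) cond.
rewrite (degradation_scale _ _ (ltW bk)).
rewrite dE (degradation_scale _ _ (ltW k0)) dotZl !dotZr dotZl.
move: opt; rewrite !(degradation_capacity _ Ep E0p).
set L := dot lambda lambda in L0 *; set e := (E0 / E) ^+ 2.
have e0 : 0 < e by rewrite exprn_gt0 // divr_gt0.
set D := degradation E0 lambda; set Dw := degradation E0 w; set lw := dot lambda w.
move=> opt H.
have DE : D = L / (beta * b * e).
  by rewrite -opt; field; rewrite !gt_eqF.
have eD : b / 2 * (beta ^+ 2 * (e * D)) = beta * L / 2.
  by rewrite DE; field; rewrite !gt_eqF.
rewrite eD.
have H2 : 2 * beta * lw - beta ^+ 2 * L <= beta * b * (e * Dw).
  have c0 : 0 < (beta * b * e) * (beta / kappa) ^+ 2.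
    exact: mulr_gt0 (mulr_gt0 (mulr_gt0 be0 b0) e0) (exprn_gt0 2 (divr_gt0 be0 k0)).
  move: H; rewrite -(ler_pM2l c0) => H.
  suff -> : beta * b * (e * Dw) = beta * b * e * (beta / kappa) ^+ 2 * ((kappa / beta) ^+ 2 * Dw).
    apply: le_trans H; rewrite DE le_eqVlt; apply/orP; left; apply/eqP.
    by field; rewrite !gt_eqF.
  by field; rewrite !gt_eqF.
have be2 : 0 < 2 * beta by rewrite mulr_gt0.
rewrite -(ler_pM2l be2).
have -> : 2 * beta * (b / 2 * (e * Dw) - lw) = beta * b * (e * Dw) - 2 * beta * lw by field.
by have -> : 2 * beta * (beta * L / 2 - beta * L) = - (beta ^+ 2 * L); [field|lra].
Qed.

(** Conversely a first order condition at the dispatch, up to a quadratic error,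
moves to [d] and to the capacity [E0]. *)
Lemma storage_necessary b E lambda kappa beta C : 0 < b -> 0 < E -> 0 < E0 ->
  lambda <> 0 -> 0 < kappa -> d = kappa *: lambda -> 0 < beta ->
  (forall h, degradation_cost b E (beta *: lambda) + dot lambda h - C * dot h h <=
             degradation_cost b E (beta *: lambda + h)) ->
  conv_condition (degradation E0 d / dot d d).
Proof.
move=> b0 Ep E0p l0 k0 dE be0 sub.
have d0 : d <> 0.
  rewrite dE => /eqP; rewrite scaler_eq0 gt_eqF //= => /eqP; exact: l0.
pose m := beta / kappa; have m0 : 0 < m by rewrite divr_gt0.
pose e := (E0 / E) ^+ 2.
have e0 : 0 < e by rewrite exprn_gt0 // divr_gt0.
have md : beta *: lambda = m *: d by rewrite dE scalerA /m divfK ?gt_eqF.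
pose sigma := (m * e * b)^-1.
have {}sub k : degradation E0 d + dot (sigma *: lambda) k *+ 2 -
    (2 * C / (e * b)) * dot k k <= degradation E0 (d + k).
  have := sub (m *: k); rewrite md -scalerDr /degradation_cost -!/(degradation _ _).
  rewrite !(degradation_capacity _ Ep E0p) -/e !(degradation_scale _ _ (ltW m0)).
  rewrite dotZr dotZl dotZr dotZl.
  set D := degradation E0 d; set Dk := degradation E0 (d + k).
  set lk := dot lambda k; set kk := dot k k => H.
  have c0 : 0 < b / 2 * e * m ^+ 2.
    by apply: mulr_gt0 (mulr_gt0 _ e0) (exprn_gt0 2 m0); apply: divr_gt0.
  rewrite -(ler_pM2l c0).
  have -> : b / 2 * e * m ^+ 2 * Dk = b / 2 * (e * (m ^+ 2 * Dk)) by ring.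
  apply: le_trans H; rewrite le_eqVlt /sigma; apply/orP; left; apply/eqP.
  by field; rewrite !gt_eqF.
have [gamma [g0 g1 gs]] := subgradient_conv sub.
have cond : conv_condition (sigma / kappa).
  by exists gamma; split => //; rewrite gs dE scalerA divfK ?gt_eqF.
by rewrite -(conv_condition_ratio d0 cond).
Qed.

End Equilibrium.

Theorem theorem2 (R : realType) (T : nat) (hT : (1 <= T)%N)
    (G S : finType) (hS : (0 < #|S|)%N)
    (c : G -> R) (hc : forall j : G, 0 < c j)
    (b : S -> R) (hb : forall i : S, 0 < b i)
    (E : S -> R) (hE : forall i : S, 0 < E i)
    (d : 'cV[R]_T) (hd : d <> 0)
    (alpha : G -> R) (beta : S -> R) (lambda : 'cV[R]_T)
    (heq : competitive_equilibrium c b E d alpha beta lambda)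
    (E0 : R) (hE0 : 0 < E0) :
  let g : G -> 'cV[R]_T := fun j => alpha j *: lambda in
  let u : S -> 'cV[R]_T := fun i => beta i *: lambda in
  let condition : Prop :=
    exists gamma : 'M[R]_T -> R,
      [/\ forall N : 'M[R]_T, associated_mx E0 d N -> 0 <= gamma N,
          \sum_(N \in associated_mx E0 d) gamma N = 1
        & \sum_(N \in associated_mx E0 d) gamma N *: (N^T *m N *m d)
          = (degradation_form E0 d d / dot d d) *: d] in
  (solves_planner_with_price c b E d g u lambda <-> condition) /\
  ((0 < #|G|)%N -> (solves_planner c b E d g u <-> condition)).
Proof.
move=> g u condition.
have [halpha hbeta balance] := heq.
pose kappa := \sum_j alpha j + \sum_i beta i.
have dE : d = kappa *: lambda by rewrite balance -!scaler_suml -scalerDl.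
have l0 : lambda <> 0 by move=> l0; apply: hd; rewrite dE l0 scaler0.
have k0 : 0 < kappa.
  rewrite lt_def addr_ge0 ?sumr_ge0 //; last 2 first.
  - by move=> j _; case: (halpha j).
  - by move=> i _; case: (hbeta i).
  by rewrite andbT; apply/eqP => k0; apply: hd; rewrite dE k0 scale0r.
have sbid i := storage_bid l0 (hb i) (hbeta i).
have gbid j := generator_bid l0 (hc j) (halpha j).
have beta0 i : 0 < beta i.
  rewrite lt_def; apply/andP; split; last by case: (hbeta i).
  apply/eqP => b0; have := sbid i; rewrite b0 mul0r => /esym/dot_eq0.
  exact: l0.
have [i0 _] : exists i0 : S, true by case/card_gt0P: hS => i _; exists i.
(* One storage unit suffices for necessity; [C] is [0] when the price is known
   to be dual optimal, and half the cost coefficient of the generator that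
   absorbs the perturbation otherwise. *)
have necessary C : (forall h,
    degradation_cost (b i0) (E i0) (u i0) + dot lambda h - C * dot h h <=
    degradation_cost (b i0) (E i0) (u i0 + h)) -> condition.
  exact: storage_necessary (hb i0) (hE i0) hE0 l0 k0 dE (beta0 i0).
have costE (g' : G -> 'cV[R]_T) u' : lagrangian c b E d g' u' lambda = dot lambda d +
    (\sum_i (degradation_cost (b i) (E i) (u' i) - dot lambda (u' i)) +
     \sum_j (generation_cost (c j) (g' j) - dot lambda (g' j))).
  rewrite /lagrangian /social_cost dotBr dotDr !dot_sumr !sumrB; ring.
have sufficient : condition -> solves_planner_with_price c b E d g u lambda.
  move=> cond.
  have lag g' u' : lagrangian c b E d g u lambda <= lagrangian c b E d g' u' lambda.
    rewrite !costE lerD2l lerD //; apply: ler_sum => k _.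
      exact: storage_supported (hb k) (hE k) hE0 l0 k0 dE (beta0 k) (sbid k) cond.
    exact: generation_supported.
  split => //; split; first exact: balance.
  move=> g' u' bal'; have := lag g' u'.
  have slack0 (g1 : G -> 'cV[R]_T) u1 : power_balance d g1 u1 ->
      lagrangian c b E d g1 u1 lambda = social_cost c b E g1 u1.
    by move=> bal; rewrite /lagrangian -bal subrr /dot mulmx0 mxE addr0.
  by rewrite (slack0 _ _ bal') (slack0 _ _ balance).
pose u_alt h i := if i == i0 then u i0 + h else u i.
split; split => //.
- move=> [_ lag]; apply: (necessary 0) => h.
  have := lag g (u_alt h); rewrite !costE lerD2l lerD2r.
  rewrite (sum_update (fun i v => degradation_cost (b i) (E i) v - dot lambda v)).
  by rewrite lerDl dotDr mul0r; lra.
- move=> [_ opt].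
  have [j0 _] : exists j0 : G, true by case/card_gt0P: H => j _; exists j.
  apply: (necessary (c j0 / 2)) => h.
  pose g_alt j := if j == j0 then g j0 - h else g j.
  have bal : power_balance d g_alt (u_alt h).
    rewrite /power_balance (sum_update (fun _ v => v)) (sum_update (fun _ v => v)).
    rewrite [u i0 + h]addrC addrK [g j0 - h]addrC addrK addrACA addNr addr0.
    exact: balance.
  have := opt _ _ bal; rewrite /social_cost.
  rewrite (sum_update (fun i v => degradation_cost (b i) (E i) v)).
  rewrite (sum_update (fun j v => generation_cost (c j) v)).
  have -> : generation_cost (c j0) (g j0 - h) =
      generation_cost (c j0) (g j0) - dot lambda h + c j0 / 2 * dot h h.
    rewrite /generation_cost /g dotBl !dotBr !dotZl !dotZr (dotC h lambda).
    set ll := dot lambda lambda; set lh := dot lambda h; set hh := dot h h.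
    have : alpha j0 * c j0 * lh = lh by rewrite gbid mul1r.
    lra.
  lra.
- by move=> /sufficient[].
Qed.
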